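(* Assuming $\mathrm{P}\neq\mathrm{NP}$, for every $P\in\mathcal{Q}$ there is a matroid decoder $f$ such that there is no Fully PTAS for $f$-decoded $P$-MOL.
   Context: A matroid is a pair $(E,\mathcal{I})$ with $E$ finite, $\emptyset\in\mathcal{I}\subseteq2^E$, closed under subsets, with the exchange property; for $\mathcal{M}=(E,\mathcal{I})$, $\mathrm{IS}(\mathcal{M})=\mathcal{I}$ and $\mathrm{bases}(\mathcal{M})$ is the set of independent sets of maximum cardinality. For a function $g$ on $E$ and $Y\subseteq E$, $g(Y)=\sum_{e\in Y}g(e)$. A function $f:\{0,1\}^*\to 2^{\mathbb{N}}\times2^{2^{\mathbb{N}}}$ is a matroid decoder if for every $I\in\{0,1\}^*$, $f(I)=(E_{f(I)},\mathcal{I}_{f(I)})$ is a matroid, and (1) given $I$, $E_{f(I)}$ can be computed in time $|I|^{O(1)}$; (2) given $I$ and $S\subseteq E_{f(I)}$, membership $S\in\mathcal{I}_{f(I)}$ can be decided in time $|I|^{O(1)}$. $\mathcal{P}=\{\max,\min\}\times\{\mathrm{bases},\mathrm{IS}\}\times\{\le,\ge\}$, $\mathcal{Q}=\mathcal{P}\setminus\{(\min,\mathrm{IS},\le)\}$. For $P=(\mathrm{opt},\mathcal{F},\triangleleft)$ and a matroid decoder $f$, $f$-decoded $P$-MOL: an instance is $(I,v,w,L)$ with $I\in\{0,1\}^*$, $v,w:E_{f(I)}\to\mathbb{R}_{\ge0}$, $L\in\mathbb{R}_{\ge0}$; a solution is $S\in\mathcal{F}(f(I))$ with $w(S)\triangleleft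 L$; the goal is to $\mathrm{opt}$imize $v(S)$. A $\rho$-approximate solution ($\rho\ge1$) has value $\ge\mathrm{OPT}/\rho$ (maximization) or $\le\rho\cdot\mathrm{OPT}$ (minimization). A Fully PTAS is a family $(A_\varepsilon)_{\varepsilon>0}$ where $A_\varepsilon$, on an instance $U$, returns a $(1+\varepsilon)$-approximate solution if a solution exists and otherwise reports that none exists, in time $(|U|/\varepsilon)^{O(1)}$, $|U|$ being the encoding size of the instance. *)

(* Defs.v *)
From HB Require Import structures.
From mathcomp Require Import all_boot all_order all_algebra finmap.

Set Implicit Arguments.
Unset Strict Implicit.
Unset Printing Implicit Defensive.

Import Order.TTheory GRing.Theory Num.Theory.

(** * Model of computation

    Multi-stack machines with structured control: finitely many stacks
    (registers) over the three-symbol alphabet {0, 1, #} are manipulated by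
    pushing, popping and branching on a topmost symbol, each at cost 1.  Two
    stacks make one Turing tape, and a finite control is a [While] around a
    [Case], so this is the multi-tape Turing machine up to a constant factor
    in running time.  *)

Notation word := (seq bool).

(* [None] is the separator #. *)
Notation symbol := (option bool).

(* The argument of the continuation of [Case] and of the guard of [While] is
   the topmost symbol of the tested stack ([None] if the stack is empty). *)
Inductive prog : Type :=
| Skip
| Push of nat & symbol
| Pop of nat
| Seq of prog & prog
| Case of nat & (option symbol -> prog)
| While of nat & (option symbol -> bool) & prog.

Definition store := nat -> seq symbol.

Definition upd (s : store) (r : nat) (u : seq symbol) : store :=
  fun i => if i == r then u else s i.

(* [exec p s t s']: started in [s], [p] halts in [s'] after [t] steps. *)
Inductive exec : prog -> store -> nat -> store -> Prop :=
| exec_skip s : exec Skip s 1 s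
| exec_push r a s : exec (Push r a) s 1 (upd s r (a :: s r))
| exec_pop r s : exec (Pop r) s 1 (upd s r (behead (s r)))
| exec_seq p q s1 s2 s3 t1 t2 :
    exec p s1 t1 s2 -> exec q s2 t2 s3 -> exec (Seq p q) s1 (t1 + t2) s3
| exec_case r k s s' t :
    exec (k (ohead (s r))) s t s' -> exec (Case r k) s t.+1 s'
| exec_while_stop r g p s :
    g (ohead (s r)) = false -> exec (While r g p) s 1 s
| exec_while_step r g p s1 s2 s3 t1 t2 :
    g (ohead (s1 r)) = true ->
    exec p s1 t1 s2 -> exec (While r g p) s2 t2 s3 ->
    exec (While r g p) s1 (t1 + t2).+1 s3.

(* Stack 0 carries the input and the output; all others start out empty. *)
Definition runs (p : prog) (input : seq symbol) (t : nat) (output : seq symbol) :=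
  exists2 s' : store,
    exec p (fun i => if i == 0 then input else [::]) t s' & s' 0 = output.

(** * Encodings *)

Definition enc_words (ws : seq word) : seq symbol :=
  flatten [seq rcons (map some u) None | u <- ws].

Fixpoint pos_bits (p : BinNums.positive) : word :=
  match p with
  | BinNums.xH => [:: true]
  | BinNums.xO p' => false :: pos_bits p'
  | BinNums.xI p' => true :: pos_bits p'
  end.

(* Binary notation, least significant bit first, no leading zeros. *)
Definition enc_nat (n : nat) : word :=
  if bin_of_nat n is BinNums.Npos p then pos_bits p else [::].

(* Only used for nonnegative rationals: numerator and denominator in lowest
   terms. *)
Definition enc_rat (x : rat) : seq word :=
  [:: enc_nat `|numq x|%N; enc_nat `|denq x|%N].

Definition elements (S : {fset nat}) : seq nat := sort leq (enum_fset S).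

Definition enc_set (S : {fset nat}) : seq word := map enc_nat (elements S).

(** * Polynomial time, P and NP *)

(* [output x] can be computed from [input x], for the [x] in the domain [D], in
   time polynomial in [sz x]. *)
Definition poly_time (T : Type) (D : T -> Prop) (sz : T -> nat)
    (input output : T -> seq symbol) : Prop :=
  exists (p : prog) (c : nat), forall x : T, D x ->
    exists2 t : nat, runs p (input x) t (output x) & t <= c * (sz x).+1 ^ c.

Definition language := word -> bool.

Definition class_P (L : language) : Prop :=
  poly_time (fun _ : word => True) size
    (fun x => enc_words [:: x]) (fun x => [:: Some (L x)]).

Definition class_NP (L : language) : Prop :=
  exists2 V : word -> word -> bool,
    poly_time (fun _ : word * word => True)
      (fun xy => size xy.1 + size xy.2)
      (fun xy => enc_words [:: xy.1; xy.2]) (fun xy => [:: Some (V xy.1 xy.2)])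
  & exists c : nat, forall x : word,
      L x <-> exists2 y : word, size y <= c * (size x).+1 ^ c & V x y.

Definition P_neq_NP : Prop := ~ (forall L : language, class_P L <-> class_NP L).

(** * Matroids and matroid decoders *)

Local Open Scope fset_scope.

(* A pair (E, I) with E a finite set of naturals, I a set of finite sets of
   naturals. *)
Notation set_system := ({fset nat} * {fset {fset nat}})%type.

Definition is_matroid (M : set_system) : Prop :=
  [/\ fset0 \in M.2,
      forall A, A \in M.2 -> A `<=` M.1,
      forall A B, A `<=` B -> B \in M.2 -> A \in M.2
    & forall A B, A \in M.2 -> B \in M.2 -> #|` A| < #|` B| ->
        exists2 e, e \in B `\` A & e |` A \in M.2].

Definition IS (M : set_system) : {fset {fset nat}} := M.2.

Definition bases (M : set_system) : {fset {fset nat}} :=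
  [fset S in M.2 | all (fun A => #|` A| <= #|` S|) (enum_fset M.2)].

Definition matroid_decoder (f : word -> set_system) : Prop :=
  [/\ forall I, is_matroid (f I),
      poly_time (fun _ : word => True) size
        (fun I => enc_words [:: I]) (fun I => enc_words (enc_set (f I).1))
    & poly_time (fun q : word * {fset nat} => q.2 `<=` (f q.1).1)
        (fun q => size q.1)
        (fun q => enc_words (q.1 :: enc_set q.2))
        (fun q => [:: Some (q.2 \in (f q.1).2)])].

(** * Matroid optimization with a linear constraint *)

Inductive objective := Max | Min.
Inductive feasible_sets := Bases | Indep.
Inductive relation := Le | Ge.

Notation problem := (objective * feasible_sets * relation)%type.

Definition in_Q (P : problem) : Prop := P <> (Min, Indep, Le).

Local Open Scope ring_scope.

(* [iv] and [iw] stand for functions on the ground set of [f iI]; their values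
   elsewhere are irrelevant.  Numbers are rational so that an instance has an
   encoding. *)
Record instance := Instance {
  iI : word;
  iv : nat -> rat;
  iw : nat -> rat;
  iL : rat
}.

Definition weight (g : nat -> rat) (S : {fset nat}) : rat := \sum_(e <- S) g e.

Definition valid_instance (f : word -> set_system) (U : instance) : Prop :=
  (forall e, e \in (f (iI U)).1 -> 0 <= iv U e /\ 0 <= iw U e) /\ 0 <= iL U.

Definition solution (f : word -> set_system) (P : problem) (U : instance)
    (S : {fset nat}) : Prop :=
  let: (_, F, rel) := P in
  S \in (match F with Bases => bases | Indep => IS end) (f (iI U)) /\
  match rel with
  | Le => weight (iw U) S <= iL U
  | Ge => weight (iw U) S >= iL U
  end.

Definition is_OPT (f : word -> set_system) (P : problem) (U : instance)
    (x : rat) : Prop :=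
  (exists2 S, solution f P U S & weight (iv U) S = x) /\
  forall S, solution f P U S ->
    match P.1.1 with
    | Max => weight (iv U) S <= x
    | Min => x <= weight (iv U) S
    end.

Definition approx_solution (f : word -> set_system) (P : problem) (rho : rat)
    (U : instance) (S : {fset nat}) : Prop :=
  solution f P U S /\
  exists2 x, is_OPT f P U x &
    match P.1.1 with
    | Max => weight (iv U) S >= x / rho
    | Min => weight (iv U) S <= rho * x
    end.

(* The instance is given by I, L and the table of (e, v(e), w(e)), e in E. *)
Definition enc_instance (f : word -> set_system) (U : instance) : seq word :=
  iI U :: enc_rat (iL U) ++
  flatten [seq enc_nat e :: enc_rat (iv U e) ++ enc_rat (iw U e)
          | e <- elements (f (iI U)).1].

(* [None] reports that there is no solution. *)
Definition enc_answer (r : option {fset nat}) : seq symbol :=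
  if r is Some A then Some true :: enc_words (enc_set A) else [:: Some false].

(* The members A_eps of the scheme are a single algorithm to which eps is part
   of the input; without such uniformity, A_eps could have the answers to all
   instances of size at most 1/eps built in.  The time bound (|U|/eps)^O(1) is
   read as "polynomial in |U| and 1/eps": for eps > |U| the literal quotient
   would not even leave time for reading U.  Counting also the bits of eps in
   the input size only enlarges the time allowed. *)
Definition has_FPTAS (f : word -> set_system) (P : problem) : Prop :=
  exists (A : prog) (c : nat), forall (eps : rat) (U : instance),
    0 < eps -> valid_instance f U ->
    let input := enc_words (enc_rat eps ++ enc_instance f U) in
    exists (t : nat) (r : option {fset nat}),
      [/\ runs A input t (enc_answer r),
          t%:R <= c%:R * ((size input)%:R + eps^-1) ^+ c
        & match r with
          | Some B => approx_solution f P (1 + eps) U B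
          | None => forall S, ~ solution f P U S
          end].

(* Main.v *)
(*
Let L be a language in NP \ P with certificates of length at most M.  For an input x take the
ground set {2^i | i < 6(M+1)}, where 2^i weighs its bit length i+1, and rank k = 2(M+1).  All sets
of fewer than k elements are independent, and so are those of k elements, except for the sets S of
total weight T that do not decode to a certificate of x.  As the weights are distinct, two
exceptional sets differ in more than one element, so this is a sparse paving matroid.  Decoding
is such that every certificate is the decoding of some k-set of weight T: each position has three
low elements (for the two bits and a blank), and the mirror images of the low elements chosen
make the total weight independent of the choice.

Hence x belongs to L iff there is an independent k-set of weight exactly T.  With w(e) = B + weight
and v(e) = B + weight or B - weight + const, for a large but polynomial B, the constraint bounds
the weight of a k-set by T on one side and the optimum of v bounds it on the other side.  As all
numbers are polynomially bounded, an FPTAS with 1/eps above the optimum is exact and decides L.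
*)
Require Import Defs.
From mathcomp Require Import all_boot all_order all_algebra finmap.
From mathcomp Require Import zify.
From Stdlib Require Import Classical FunctionalExtensionality.

Set Implicit Arguments.
Unset Strict Implicit.
Unset Printing Implicit Defensive.

Import Order.TTheory GRing.Theory Num.Theory.

(** * Polynomial time *)

Notation put := (@set_nth (seq symbol) [::]).
Notation get := (@nth (seq symbol) [::]).

(* A store is split into its first 16 registers, listed in [l], and the rest [g], which serves
   as the work space of the machines that are given only by their existence. *)
Definition st (l : seq (seq symbol)) (g : store) : store :=
  fun i => if i < 16 then get l i else g i.

(** States are compared by [get] only, so an empty register may be written as [[::]] or left out at
    the end of the list. *)
Lemma eq_st l l' g : (forall i, get l i = get l' i) -> st l g = st l' g.
Proof. by move=> e; apply: functional_extensionality => i; rewrite /st e. Qed.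

Lemma get_put l r u i : get (put l r u) i = if i == r then u else get l i.
Proof. by rewrite nth_set_nth. Qed.

Lemma upd_st l g r u : r < 16 -> upd (st l g) r u = st (put l r u) g.
Proof.
move=> ltr; apply: functional_extensionality => i; rewrite /upd /st get_put.
by case: eqP => [->|//]; rewrite ltr.
Qed.

Lemma st_lt l g r : r < 16 -> st l g r = get l r.
Proof. by rewrite /st => ->. Qed.

(** The form of bound demanded by [poly_time], with one constant as coefficient and exponent. *)
Definition pbound z c := c * z.+1 ^ c.

Lemma pbound_mono z c d : c <= d -> pbound z c <= pbound z d.
Proof. by move=> le; rewrite leq_mul // leq_pexp2l. Qed.

Section Polynomial.
Variables (X : Type) (D : X -> Prop) (sz : X -> nat).

Definition polyb (b : X -> nat) := exists c, forall x, D x -> b x <= pbound (sz x) c.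

Lemma polyb_const c : polyb (fun=> c).
Proof. by exists c => x _; rewrite leq_pmulr // expn_gt0. Qed.

Lemma polyb_size : polyb sz.
Proof. by exists 1 => x _; rewrite /pbound mul1n expn1. Qed.

Lemma polyb_le b b' : (forall x, D x -> b x <= b' x) -> polyb b' -> polyb b.
Proof. by move=> le [c H]; exists c => x Dx; apply: leq_trans (le x Dx) (H x Dx). Qed.

Lemma polyb_add b b' : polyb b -> polyb b' -> polyb (fun x => b x + b' x).
Proof.
move=> [c H] [d H']; exists (c + d) => x Dx.
rewrite {1}/pbound mulnDl leq_add //.
  by apply: leq_trans (H x Dx) _; rewrite leq_mul // leq_pexp2l // leq_addr.
by apply: leq_trans (H' x Dx) _; rewrite leq_mul // leq_pexp2l // leq_addl.
Qed.

Lemma polyb_mul b b' : polyb b -> polyb b' -> polyb (fun x => b x * b' x).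
Proof.
(* The product has coefficient [c * d] and exponent [c + d]; their sum dominates both. *)
move=> [c H] [d H']; exists (c * d + (c + d)) => x Dx.
apply: leq_trans (leq_mul (H x Dx) (H' x Dx)) _.
rewrite /pbound mulnACA -expnD leq_mul ?leq_addr // leq_pexp2l //.
exact: leq_addl.
Qed.

Lemma polyb_exp b c : polyb b -> polyb (fun x => b x ^ c).
Proof.
move=> Hb; elim: c => [|c IH]; first exact: polyb_const.
apply: (polyb_le (b' := fun x => b x * b x ^ c)) => [x _|]; first by rewrite expnS.
exact: polyb_mul.
Qed.

Lemma polyb_S b : polyb b -> polyb (fun x => (b x).+1).
Proof.
move=> Hb; apply: (polyb_le (b' := fun x => b x + 1)) => [x _|]; first by rewrite addn1.
by apply: polyb_add => //; apply: polyb_const.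
Qed.

End Polynomial.

Lemma polyb_comp X Y (D : X -> Prop) (D' : Y -> Prop) (sz b : X -> nat) (f : Y -> X) :
  (forall y, D' y -> D (f y)) -> polyb D sz b ->
  polyb D' (fun y => sz (f y)) (fun y => b (f y)).
Proof. by move=> DD [c H]; exists c => y /DD Dy; apply: H. Qed.

Definition ok p s s' n := exists2 t, exec p s t s' & t <= n.

(* Families of runs, with one polynomial bound for all x in D.  A loop body is analysed as a
   family over pairs (x, i), with i the number of completed iterations; as its bound depends on
   sz x only, no explicit time bounds are needed. *)
Definition pt X (D : X -> Prop) (sz : X -> nat) p (s s' : X -> seq (seq symbol)) :=
  exists c, forall x g, D x -> ok p (st (s x) g) (st (s' x) g) (pbound (sz x) c).

Section Rules.
Variables (X : Type) (D : X -> Prop) (sz : X -> nat).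
Implicit Types s : X -> seq (seq symbol).

Lemma pt_polyb b p s s' : polyb D sz b ->
  (forall x g, D x -> ok p (st (s x) g) (st (s' x) g) (b x)) -> pt D sz p s s'.
Proof.
move=> [c Hc] H; exists c => x g Dx; have [t Ht le] := H x g Dx.
by exists t => //; apply: leq_trans le (Hc x Dx).
Qed.

Lemma pt_eq s1 s1' s2 s2' p :
  (forall x, D x -> forall i, get (s1 x) i = get (s1' x) i) ->
  (forall x, D x -> forall i, get (s2 x) i = get (s2' x) i) ->
  pt D sz p s1' s2' -> pt D sz p s1 s2.
Proof.
move=> e1 e2 [c H]; exists c => x g Dx.
by rewrite (eq_st _ (e1 x Dx)) (eq_st _ (e2 x Dx)); apply: H.
Qed.

Lemma pt_eqr s1 s2 s2' p :
  pt D sz p s1 s2' ->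
  (forall x, D x -> forall i, get (s2 x) i = get (s2' x) i) ->
  pt D sz p s1 s2.
Proof. by move=> H e; apply: pt_eq H => // x Dx i; rewrite e. Qed.

Lemma pt_skip s : pt D sz Skip s s.
Proof.
by apply: (pt_polyb (polyb_const D sz 1)) => x g _; exists 1 => //; apply: exec_skip.
Qed.

Lemma pt_push r a s : r < 16 ->
  pt D sz (Push r a) s (fun x => put (s x) r (a :: get (s x) r)).
Proof.
move=> ltr; apply: (pt_polyb (polyb_const D sz 1)) => x g _; exists 1 => //.
by rewrite -upd_st // -(st_lt _ g ltr); apply: exec_push.
Qed.

Lemma pt_pop r s : r < 16 ->
  pt D sz (Pop r) s (fun x => put (s x) r (behead (get (s x) r))).
Proof.
move=> ltr; apply: (pt_polyb (polyb_const D sz 1)) => x g _; exists 1 => //.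
by rewrite -upd_st // -(st_lt _ g ltr); apply: exec_pop.
Qed.

Lemma pt_seq p q s1 s2 s3 :
  pt D sz p s1 s2 -> pt D sz q s2 s3 -> pt D sz (Seq p q) s1 s3.
Proof.
move=> [c Hp] [d Hq].
apply: (@pt_polyb (fun x => pbound (sz x) c + pbound (sz x) d)) => [|x g Dx].
  by apply: polyb_add; [exists c | exists d].
have [t1 E1 le1] := Hp x g Dx; have [t2 E2 le2] := Hq x g Dx.
by exists (t1 + t2); [apply: exec_seq E1 E2 | rewrite leq_add].
Qed.

(** The tested stack shows one of only four values, so the sum of the four constants serves all
    branches. The value seen joins the domain of its branch, which lets impossible branches be
    dismissed. *)
Lemma pt_case r k s s' : r < 16 ->
  (forall o, pt (fun x => D x /\ ohead (get (s x) r) = o) sz (k o) s s') ->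
  pt D sz (Case r k) s s'.
Proof.
move=> ltr H.
have [c0 H0] := H None; have [c1 H1] := H (Some None).
have [c2 H2] := H (Some (Some true)); have [c3 H3] := H (Some (Some false)).
apply: (@pt_polyb (fun x => (pbound (sz x) (c0 + c1 + c2 + c3)).+1)) => [|x g Dx].
  by apply: polyb_S; exists (c0 + c1 + c2 + c3).
suff [t E le] : ok (k (ohead (get (s x) r))) (st (s x) g) (st (s' x) g)
    (pbound (sz x) (c0 + c1 + c2 + c3)).
  by exists t.+1 => //; apply: exec_case; rewrite st_lt.
case eo: (ohead _) => [[[|]|]|].
- have [t E le] := H2 x g (conj Dx eo); exists t => //.
  by apply: leq_trans le (pbound_mono _ _); lia.
- have [t E le] := H3 x g (conj Dx eo); exists t => //.
  by apply: leq_trans le (pbound_mono _ _); lia.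
- have [t E le] := H1 x g (conj Dx eo); exists t => //.
  by apply: leq_trans le (pbound_mono _ _); lia.
have [t E le] := H0 x g (conj Dx eo); exists t => //.
by apply: leq_trans le (pbound_mono _ _); lia.
Qed.

Lemma pt_while r g p s s' (n : X -> nat) (inv : X -> nat -> seq (seq symbol)) :
  r < 16 -> polyb D sz n ->
  (forall x, D x -> forall i, get (s x) i = get (inv x 0) i) ->
  (forall x, D x -> forall i, get (s' x) i = get (inv x (n x)) i) ->
  (forall x i, D x -> i < n x -> g (ohead (get (inv x i) r)) = true) ->
  (forall x, D x -> g (ohead (get (inv x (n x)) r)) = false) ->
  pt (fun xi => D xi.1 /\ xi.2 < n xi.1) (fun xi => sz xi.1) p
    (fun xi => inv xi.1 xi.2) (fun xi => inv xi.1 xi.2.+1) ->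
  pt D sz (While r g p) s s'.
Proof.
move=> ltr Pn es es' gt gf [c Hp]; apply: (pt_eq es es').
apply: (@pt_polyb (fun x => n x * (pbound (sz x) c).+1 + 1)) => [|x h Dx].
  apply: polyb_add; last exact: polyb_const.
  by apply: polyb_mul => //; apply: polyb_S; exists c.
(* Induction on the number j of iterations still to come, from the state after [n x - j] of them. *)
suff H j : j <= n x -> ok (While r g p) (st (inv x (n x - j)) h)
    (st (inv x (n x)) h) (j * (pbound (sz x) c).+1 + 1).
  by have := H (n x) (leqnn _); rewrite subnn.
elim: j => [_|j IH lt].
  by rewrite subn0; exists 1 => //; apply: exec_while_stop; rewrite st_lt ?gf.
have [t2 E2 le2] := IH (ltnW lt).
have e : n x - j = (n x - j.+1).+1 by lia.
have lti : n x - j.+1 < n x by lia.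
have [t1 E1 le1] := Hp (x, n x - j.+1) h (conj Dx lti).
exists (t1 + t2).+1; last by move: le1 le2 => /=; lia.
apply: exec_while_step E1 _; first by rewrite st_lt ?gt.
by rewrite /= -e.
Qed.

Lemma pt_sub (D' : X -> Prop) p s s' : (forall x, D x -> D' x) ->
  pt D' sz p s s' -> pt D sz p s s'.
Proof. by move=> DD [c H]; exists c => x g /DD; apply: H. Qed.

End Rules.

(** * Basic programs *)

(** On an empty stack a the default would push a separator onto b; every use ensures that a is
    nonempty. *)
Definition xfer a b := Case a (fun o => Seq (Push b (odflt None o)) (Pop a)).
Definition nonempty (o : option symbol) : bool := o.
Definition mv a b := While a nonempty (xfer a b).
(** Unary arithmetic: [addu] adds the length of a to b and [mulu] the product of the lengths of a
    and d, in copies of c. The stacks t, t1, t2 start empty and serve to rebuild the operands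
    consumed. *)
Definition addu c a b t := Seq (While a nonempty (Seq (xfer a t) (Push b c))) (mv t a).
Definition mulu c a d b t1 t2 :=
  Seq (While d nonempty (Seq (xfer d t2) (addu c a b t1))) (mv t2 d).
Definition clr a := While a nonempty (Pop a).

Section Subroutines.
Variables (X : Type) (D : X -> Prop) (sz : X -> nat).
Implicit Types s : X -> seq (seq symbol).

Lemma pt_xfer a b s : a < 16 -> b < 16 -> a != b ->
  pt D sz (xfer a b) s (fun x => put (put (s x) b (odflt None (ohead (get (s x) a)) :: get (s x) b))
     a (behead (get (s x) a))).
Proof.
move=> lta ltb ab; apply: pt_case => // o.
apply: (pt_seq (pt_push _ _ _ _ _)) => //.
apply: (pt_eqr (pt_pop _ _ _ _)) => // x [Dx eo] i.
by rewrite eo !get_put (negPf ab).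
Qed.

(** The loop rule for a stack that loses one symbol per round: the guard conditions follow from its
    size. *)
Lemma pt_while_list a p s s' (inv : X -> nat -> seq (seq symbol)) :
  a < 16 -> polyb D sz (fun x => size (get (s x) a)) ->
  (forall x, D x -> forall i, get (s x) i = get (inv x 0) i) ->
  (forall x, D x -> forall i, get (s' x) i = get (inv x (size (get (s x) a))) i) ->
  (forall x i, D x -> size (get (inv x i) a) = size (get (s x) a) - i) ->
  pt (fun xi => D xi.1 /\ xi.2 < size (get (s xi.1) a)) (fun xi => sz xi.1) p
    (fun xi => inv xi.1 xi.2) (fun xi => inv xi.1 xi.2.+1) ->
  pt D sz (While a nonempty p) s s'.
Proof.
move=> lta Pn e0 e1 es Hp; apply: (pt_while lta Pn e0 e1) => //.
  move=> x i Dx lt; have := es x i Dx.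
  by case: (get (inv x i) a) => //= e; move: lt; rewrite -subn_gt0 -e.
move=> x Dx; have := es x (size (get (s x) a)) Dx; rewrite subnn.
by case: (get _ a).
Qed.

End Subroutines.

Section Subroutines.
Variables (X : Type) (D : X -> Prop) (sz : X -> nat).
Implicit Types s : X -> seq (seq symbol).

Lemma pt_mv a b s : a < 16 -> b < 16 -> a != b ->
  polyb D sz (fun x => size (get (s x) a)) ->
  pt D sz (mv a b) s (fun x => put (put (s x) b (rev (get (s x) a) ++ get (s x) b)) a [::]).
Proof.
move=> lta ltb ab Pn.
pose inv x i := put (put (s x) b (rev (take i (get (s x) a)) ++ get (s x) b)) a (drop i (get (s x) a)).
apply: (pt_while_list (inv := inv)) => //.
- move=> x Dx i; rewrite /inv take0 drop0 !get_put.
  by case: eqP => [->//|_]; case: eqP => [->//|_].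
- by move=> x Dx i; rewrite /inv take_size drop_size.
- by move=> x i Dx; rewrite /inv get_put eqxx size_drop.
apply: (pt_eqr (pt_xfer _ _ _ _ _ _)) => // -[x j] [/= Dx lt] i.
rewrite /inv !get_put eqxx; case: eqP => _; first by rewrite -addn1 addnC -drop_drop drop1.
rewrite !eqxx [b == a]eq_sym (negPf ab); case: eqP => _ //.
by rewrite (drop_nth None lt) (take_nth None lt) rev_rcons.
Qed.
End Subroutines.

Section Subroutines.
Variables (X : Type) (D : X -> Prop) (sz : X -> nat).
Implicit Types s : X -> seq (seq symbol).

Lemma pt_clr a s : a < 16 -> polyb D sz (fun x => size (get (s x) a)) ->
  pt D sz (clr a) s (fun x => put (s x) a [::]).
Proof.
move=> lta Pn.
pose inv x i := put (s x) a (drop i (get (s x) a)).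
apply: (pt_while_list (inv := inv)) => //.
- by move=> x Dx i; rewrite /inv drop0 get_put; case: eqP => [->|].
- by move=> x Dx i; rewrite /inv drop_size.
- by move=> x i Dx; rewrite /inv get_put eqxx size_drop.
apply: (pt_eqr (pt_pop _ _ _ _)) => // -[x j] [/= Dx lt] i.
by rewrite /inv !get_put eqxx; case: eqP => _ //; rewrite -addn1 addnC -drop_drop drop1.
Qed.

Lemma pt_addu c a b t s : a < 16 -> b < 16 -> t < 16 -> uniq [:: a; b; t] ->
  polyb D sz (fun x => size (get (s x) a)) ->
  (forall x, D x -> get (s x) t = [::]) ->
  pt D sz (addu c a b t) s
    (fun x => put (s x) b (nseq (size (get (s x) a)) c ++ get (s x) b)).
Proof.
move=> lta ltb ltt /and3P[]; rewrite !inE negb_or => /andP[ab at'] bt _ Pn t0.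
have := (eq_sym b a, eq_sym t a, eq_sym t b).
rewrite (negPf ab) (negPf at') (negPf bt) => es.
have ns := (es, (negPf ab, negPf at', negPf bt)).
pose inv x i := put (put (put (s x) b (nseq i c ++ get (s x) b)) t
  (rev (take i (get (s x) a)))) a (drop i (get (s x) a)).
apply: (pt_seq (s2 := fun x => inv x (size (get (s x) a)))).
  apply: (pt_while_list (inv := inv)) => //.
  - move=> x Dx i; rewrite /inv take0 drop0 !get_put.
    by case: eqP => [->//|_]; case: eqP => [->|_]; [rewrite t0|case: eqP => [->|]].
  - by move=> x i Dx; rewrite /inv get_put eqxx size_drop.
  apply: pt_seq; first by apply: pt_xfer.
  apply: (pt_eqr (pt_push _ _ _ _ _)) => // -[x j] [/= Dx lt] i.
  rewrite /inv !get_put !eqxx !ns.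
  case: (i =P a) => [->|_]; first by rewrite ns -addn1 addnC -drop_drop drop1.
  case: (i =P b) => [->|_]; first by rewrite !ns.
  by case: eqP => // _; rewrite (drop_nth None lt) (take_nth None lt) rev_rcons.
apply: (pt_eqr (pt_mv _ _ _ _)) => //.
- by rewrite eq_sym.
- by apply: polyb_le Pn => x Dx; rewrite /inv !get_put ns eqxx take_size size_rev.
move=> x Dx i.
rewrite /inv !get_put !eqxx !ns take_size drop_size revK cats0.
case: (i =P t) => [->|_]; first by rewrite t0 // ns.
by case: (i =P a) => [->|_] //; rewrite ns.
Qed.

End Subroutines.

Section Subroutines.
Variables (X : Type) (D : X -> Prop) (sz : X -> nat).
Implicit Types s : X -> seq (seq symbol).

Lemma pt_mulu c a d b t1 t2 s :
  [&& a < 16, d < 16, b < 16, t1 < 16 & t2 < 16] -> uniq [:: a; d; b; t1; t2] ->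
  polyb D sz (fun x => size (get (s x) a)) ->
  polyb D sz (fun x => size (get (s x) d)) ->
  (forall x, D x -> get (s x) t1 = [::]) -> (forall x, D x -> get (s x) t2 = [::]) ->
  pt D sz (mulu c a d b t1 t2) s
    (fun x => put (s x) b (nseq (size (get (s x) a) * size (get (s x) d)) c ++ get (s x) b)).
Proof.
move=> /and5P[lta ltd ltb lt1 lt2] un Pa Pd e1 e2.
move: un; rewrite /= !inE !negb_or -!andbA.
move=> /and5P[ad ab a1 a2 /and5P[db d1 d2 b1 /and3P[b2 d12 _]]].
have := (eq_sym d a, eq_sym b a, eq_sym t1 a, eq_sym t2 a, eq_sym b d, eq_sym t1 d, eq_sym t2 d,
  eq_sym t1 b, eq_sym t2 b, eq_sym t2 t1).
have ns' := (negPf ad, negPf ab, negPf a1, negPf a2, negPf db, negPf d1, negPf d2, negPf b1,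
  negPf b2, negPf d12).
rewrite !ns' => es; have ns := (es, ns').
pose inv x i := put (put (put (s x) b (nseq (size (get (s x) a) * i) c ++ get (s x) b)) t2
  (rev (take i (get (s x) d)))) d (drop i (get (s x) d)).
apply: (pt_seq (s2 := fun x => inv x (size (get (s x) d)))).
  apply: (pt_while_list (inv := inv)) => //.
  - move=> x Dx i; rewrite /inv muln0 take0 drop0 !get_put.
    by case: eqP => [->//|_]; case: eqP => [->|_]; [rewrite e2|case: eqP => [->|]].
  - by move=> x i Dx; rewrite /inv get_put eqxx size_drop.
  apply: pt_seq; first by apply: pt_xfer; rewrite ?ns.
  apply: (pt_eqr (pt_addu _ _ _ _ _ _ _)) => //.
  - by rewrite /= !inE !ns.
  - apply: (polyb_le (b' := fun xi => size (get (s xi.1) a))) => [[x i] [/= Dx _]|].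
      by rewrite /inv !get_put !ns.
    by apply: (polyb_comp (f := fst)) Pa => -[x i] [].
  - by move=> [x i] [/= Dx _]; rewrite /inv !get_put !ns e1.
  move=> [x j] [/= Dx lt] i.
  rewrite /inv !get_put ?(eqxx,ns).
  case: (i =P d) => [->|_]; first by rewrite ns -addn1 addnC -drop_drop drop1.
  case: (i =P b) => [->|_]; first by rewrite !ns mulnS nseqD catA.
  by case: eqP => // _; rewrite (drop_nth None lt) (take_nth None lt) rev_rcons.
apply: (pt_eqr (pt_mv _ _ _ _)) => //.
- by rewrite ns.
- by apply: polyb_le Pd => x Dx; rewrite /inv !get_put ns eqxx take_size size_rev.
move=> x Dx i.
rewrite /inv !get_put !eqxx !ns take_size drop_size revK cats0.
case: (i =P t2) => [->|_]; first by rewrite e2 // ns.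
by case: (i =P d) => [->|_] //; rewrite ns.
Qed.
End Subroutines.

(** * Polynomial bounds for lengths of lists *)

Section PolynomialLists.
Variables (X : Type) (D : X -> Prop) (sz : X -> nat) (T : Type).
Implicit Types u v : X -> seq T.

Lemma polyb_nseq (n : X -> nat) (a : T) : polyb D sz n -> polyb D sz (fun x => size (nseq (n x) a)).
Proof. by apply: polyb_le => x _; rewrite size_nseq. Qed.

Lemma polyb_cat u v : polyb D sz (fun x => size (u x)) -> polyb D sz (fun x => size (v x)) ->
  polyb D sz (fun x => size (u x ++ v x)).
Proof.
move=> Hu Hv; apply: (polyb_le (b' := fun x => size (u x) + size (v x))) => [x _|].
  by rewrite size_cat.
exact: polyb_add.
Qed.

Lemma polyb_rev u : polyb D sz (fun x => size (u x)) -> polyb D sz (fun x => size (rev (u x))).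
Proof. by apply: polyb_le => x _; rewrite size_rev. Qed.

Lemma polyb_map (A : Type) (f : T -> A) u : polyb D sz (fun x => size (u x)) ->
  polyb D sz (fun x => size (map f (u x))).
Proof. by apply: polyb_le => x _; rewrite size_map. Qed.

Lemma polyb_fst (b : X -> nat) (D' : X * nat -> Prop) : polyb D sz b ->
  (forall xi, D' xi -> D xi.1) -> polyb D' (fun xi => sz xi.1) (fun xi => b xi.1).
Proof. by move=> Pb DD; apply: (polyb_comp (f := fst)) Pb. Qed.

End PolynomialLists.

(** Compares two explicitly listed states register by register. *)
Ltac lits_upto n i :=
  lazymatch n with
  | S ?m => destruct i as [|i]; [cbn [nth] | lits_upto m i]
  | O => rewrite /= ?nth_nil
  end.
Ltac lits :=
  intros; match goal with |- nth _ _ ?i = _ => lits_upto constr:(16%nat) i end; try done.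

Lemma behead_nseq (T : Type) n (a : T) : behead (nseq n a) = nseq n.-1 a.
Proof. by case: n. Qed.

Definition isbit (o : option symbol) : bool := if o is Some (Some _) then true else false.
(** The first word of the input ends up reversed on stack 1 below its separator, so that [mv 1 0]
    later puts back both. *)
Definition readx := Seq (While 0 isbit (xfer 0 1)) (xfer 0 1).

Lemma pt_readx X (D : X -> Prop) sz (w : X -> word) (u : X -> seq symbol) :
  polyb D sz (fun x => size (w x)) ->
  pt D sz readx (fun x => [:: map some (w x) ++ None :: u x; [::]])
    (fun x => [:: u x; None :: rev (map some (w x))]).
Proof.
move=> Pw.
pose inv x i := [:: map some (drop i (w x)) ++ None :: u x; rev (map some (take i (w x)))].
apply: (pt_seq (s2 := fun x => inv x (size (w x)))); last first.
  apply: (pt_eqr (pt_xfer _ _ _ _ _ _)) => // x Dx.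
  by rewrite /inv drop_size take_size.
apply: (pt_while (n := fun x => size (w x)) (inv := inv)) => //.
- by move=> x Dx; rewrite /inv drop0 take0.
- by move=> x i Dx lt; rewrite /inv /= (drop_nth true lt).
- by move=> x Dx; rewrite /inv /= drop_size.
apply: (pt_eqr (pt_xfer _ _ _ _ _ _)) => // -[x i] [/= Dx lt].
by rewrite /inv /= (drop_nth true lt) (take_nth true lt) map_rcons rev_rcons.
Qed.

(** * Converting unary counters to binary *)

Fixpoint incw (w : word) : word :=
  match w with true :: w' => false :: incw w' | false :: w' => true :: w' | [::] => [:: true] end.

(** The carry turns the leading run of ones, of length [find negb w], into zeros and sets the next
    bit; [inc] works in these two phases. *)
Lemma incwE w :
  incw w = nseq (find negb w) false ++ true :: behead (drop (find negb w) w).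
Proof. by elim: w => //= -[] //= w ->. Qed.

Definition istrue (o : option symbol) : bool := if o is Some (Some true) then true else false.
Definition inc := Seq (While 13 istrue (Seq (Pop 13) (Push 14 (Some false))))
  (Seq (Pop 13) (Seq (Push 13 (Some true)) (mv 14 13))).
Definition u2b := While 12 nonempty (Seq (Pop 12) inc).
(** Two transfers keep the order of the bits, with the least significant one on top. *)
Definition emit := Seq u2b (Seq (Push 0 None) (Seq (mv 13 14) (mv 14 0))).

(** [incw] is [BinPos.Pos.succ] read on the bits, and [bin_of_nat] inverts [nat_of_bin]. *)
Lemma enc_natS n : enc_nat n.+1 = incw (enc_nat n).
Proof.
have ebin p : enc_nat (nat_of_pos p) = pos_bits p.
  by rewrite /enc_nat -[nat_of_pos p]/(nat_of_bin (BinNums.Npos p)) nat_of_binK.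
have inc_pos p : pos_bits (BinPos.Pos.succ p) = incw (pos_bits p).
  by elim: p => //= p ->.
case: n => [|n]; first by [].
rewrite -[n.+1]bin_of_natK /=; set p := pos_of_nat n n.
by rewrite ebin -inc_pos -ebin nat_of_succ_pos.
Qed.

(** A crude bound suffices, since the numbers written are polynomially bounded. *)
Lemma size_enc_nat n : size (enc_nat n) <= n.
Proof.
elim: n => // n IH; rewrite enc_natS; apply: leq_trans (_ : (size (enc_nat n)).+1 <= _) => //.
by elim: (enc_nat n) {IH} => //= -[].
Qed.

Lemma find_negb_nth w i : i < find negb w -> nth false w i.
Proof. by move/(before_find false)/negbFE. Qed.

Section Emit.
Variables (X : Type) (D : X -> Prop) (sz : X -> nat).
Variables (r0 r1 r2 r3 r4 r5 r6 r7 r8 r9 r10 r11 : X -> seq symbol).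

Lemma pt_inc r12 (w : X -> word) : polyb D sz (fun x => size (w x)) ->
  pt D sz inc (fun x => [:: r0 x; r1 x; r2 x; r3 x; r4 x; r5 x; r6 x; r7 x; r8 x; r9 x; r10 x; r11 x;
      r12 x; map some (w x); [::]])
    (fun x => [:: r0 x; r1 x; r2 x; r3 x; r4 x; r5 x; r6 x; r7 x; r8 x; r9 x; r10 x; r11 x;
      r12 x; map some (incw (w x)); [::]]).
Proof.
move=> Pw; pose a x := find negb (w x).
have Pa : polyb D sz a by apply: polyb_le Pw => x _; apply: find_size.
pose inv x i := [:: r0 x; r1 x; r2 x; r3 x; r4 x; r5 x; r6 x; r7 x; r8 x; r9 x; r10 x; r11 x;
      r12 x; map some (drop i (w x)); nseq i (Some false)].
apply: (pt_seq (s2 := fun x => inv x (a x))).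
  apply: (pt_while (n := a) (inv := inv)) => //.
  - by move=> x Dx; rewrite /inv drop0.
  - move=> x i Dx lt; rewrite /inv /= (drop_nth false) /=; last first.
      by apply: leq_trans lt (find_size _ _).
    by rewrite find_negb_nth.
  - move=> x Dx; rewrite /inv /=; case e: (a x == size (w x)).
      by rewrite (eqP e) drop_size.
    have lt : a x < size (w x) by rewrite ltn_neqAle e find_size.
    rewrite (drop_nth false lt) /=; have := nth_find false (a := negb) (s := w x).
    by rewrite has_find lt => /(_ isT); rewrite -/(a x); case: nth.
  apply: pt_seq; first by apply: pt_pop.
  apply: (pt_eqr (pt_push _ _ _ _ _)) => // -[x i] [/= Dx lt].
  by rewrite /inv /= (drop_nth false (leq_trans lt (find_size _ _))).
(* If all bits were ones, the stack is empty by now and this pop has no effect. *)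
apply: pt_seq; first by apply: pt_pop.
apply: pt_seq; first by apply: pt_push.
apply: (pt_eqr (pt_mv _ _ _ _)) => //=; first exact: polyb_nseq.
by move=> x Dx; rewrite rev_nseq incwE map_cat map_nseq /= -behead_map.
Qed.

End Emit.

Section Emit.
Variables (X : Type) (D : X -> Prop) (sz : X -> nat).
Variables (r0 r1 r2 r3 r4 r5 r6 r7 r8 r9 r10 r11 : X -> seq symbol).

Lemma pt_emit (n : X -> nat) : polyb D sz n ->
  pt D sz emit (fun x => [:: r0 x; r1 x; r2 x; r3 x; r4 x; r5 x; r6 x; r7 x; r8 x; r9 x; r10 x; r11 x;
      nseq (n x) None; [::]; [::]])
    (fun x => [:: map some (enc_nat (n x)) ++ None :: r0 x; r1 x; r2 x; r3 x; r4 x; r5 x; r6 x;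
      r7 x; r8 x; r9 x; r10 x; r11 x; [::]; [::]; [::]]).
Proof.
move=> Pn.
pose inv x i := [:: r0 x; r1 x; r2 x; r3 x; r4 x; r5 x; r6 x; r7 x; r8 x; r9 x; r10 x; r11 x;
      nseq (n x - i) None; map some (enc_nat i); [::]].
apply: (pt_seq (s2 := fun x => inv x (n x))).
  apply: (pt_while_list (inv := inv)) => //=.
  - exact: polyb_nseq.
  - by move=> x Dx; rewrite /inv subn0.
  - by move=> x Dx; rewrite /inv size_nseq.
  - by move=> x i Dx; rewrite !size_nseq.
  apply: pt_seq; first by apply: pt_pop.
  apply: (pt_eqr (pt_inc _ _ _ _ _ _ _ _ _ _ _ _ _ _)) => /=.
    apply: (polyb_le (b' := fun xi => n xi.1)) => [[x i] [/= _ lt]|].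
      by rewrite size_nseq in lt; apply: leq_trans (size_enc_nat _) (ltnW lt).
    by apply: polyb_fst Pn _ => -[x i] [].
  move=> [x i] [/= Dx]; rewrite size_nseq => lt.
  by rewrite /inv /= enc_natS behead_nseq subnS.
apply: pt_seq; first by apply: pt_push.
apply: pt_seq.
  apply: pt_mv => //=; apply: polyb_map; apply: polyb_le Pn => x _; exact: size_enc_nat.
apply: (pt_eqr (pt_mv _ _ _ _)) => //=.
  apply: polyb_cat; last exact: polyb_const.
  apply: polyb_rev; apply: polyb_map; apply: polyb_le Pn => x _; exact: size_enc_nat.
by move=> x Dx; rewrite cats0 revK subnn.
Qed.

End Emit.

(** * Calling a given program *)

Fixpoint ren (h : nat -> nat) (p : prog) : prog :=
  match p with
  | Skip => Skip
  | Push r a => Push (h r) a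
  | Pop r => Pop (h r)
  | Seq p q => Seq (ren h p) (ren h q)
  | Case r k => Case (h r) (fun o => ren h (k o))
  | While r g p => While (h r) g (ren h p)
  end.

(** A renamed program touches only stacks in the image of h; injectivity keeps distinct stacks
    distinct. *)
Lemma exec_ren h p s t s' : injective h -> exec p s t s' ->
  forall u, (forall i, u (h i) = s i) -> exists u',
  [/\ exec (ren h p) u t u', forall i, u' (h i) = s' i
    & forall j, (forall i, j <> h i) -> u' j = u j].
Proof.
move=> hI; elim=> {p s t s'} /=.
- by move=> s u us; exists u; split=> //; apply: exec_skip.
- move=> r a s u us; exists (upd u (h r) (a :: s r)); split.
  + by rewrite -us; apply: exec_push.
  + by move=> i; rewrite /upd inj_eq // us.
  by move=> j nj; rewrite /upd; case: eqP => // /nj.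
- move=> r s u us; exists (upd u (h r) (behead (s r))); split.
  + by rewrite -us; apply: exec_pop.
  + by move=> i; rewrite /upd inj_eq // us.
  by move=> j nj; rewrite /upd; case: eqP => // /nj.
- move=> p q s1 s2 s3 t1 t2 _ IHp _ IHq u us.
  have [u1 [E1 e1 f1]] := IHp u us; have [u2 [E2 e2 f2]] := IHq u1 e1.
  exists u2; split=> //; first exact: exec_seq E1 E2.
  by move=> j nj; rewrite f2 // f1.
- move=> r k s s' t _ IH u us; have [u1 [E1 e1 f1]] := IH u us.
  by exists u1; split=> //; apply: exec_case; rewrite us.
- by move=> r g p s gf u us; exists u; split=> //; apply: exec_while_stop; rewrite us.
move=> r g p s1 s2 s3 t1 t2 gt _ IHp _ IHq u us.
have [u1 [E1 e1 f1]] := IHp u us; have [u2 [E2 e2 f2]] := IHq u1 e1.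
exists u2; split=> //; last by move=> j nj; rewrite f2 // f1.
by apply: exec_while_step E1 E2; rewrite us.
Qed.

(** A step pushes at most one symbol. This bounds the answers of programs given only by their
    existence. *)
Lemma exec_size p s t s' : exec p s t s' -> forall r, size (s' r) <= size (s r) + t.
Proof.
elim=> {p s t s'} /=.
- by move=> s r; rewrite leq_addr.
- by move=> r a s i; rewrite /upd; case: eqP => [->|_] /=; rewrite ?addn1 // leq_addr.
- move=> r s i; rewrite /upd; case: eqP => [->|_] /=; rewrite ?leq_addr //.
  by rewrite size_behead; lia.
- by move=> p q s1 s2 s3 t1 t2 _ H1 _ H2 r; have := H1 r; have := H2 r; lia.
- by move=> r k s s' t _ H i; have := H i; lia.
- by move=> r g p s _ i; rewrite leq_addr.
by move=> r g p s1 s2 s3 t1 t2 _ _ H1 _ H2 i; have := H1 i; have := H2 i; lia.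
Qed.

(* Moves the work stacks of a program out of the registers below 16. *)
Definition away (i : nat) := if i == 0 then 0 else i + 16.
Definition call p := ren away p.

Definition nostore : store := fun=> [::].

Lemma st_init u : st [:: u] nostore = (fun i => if i == 0 then u else [::]).
Proof.
apply: functional_extensionality => i; rewrite /st /nostore.
by case: i => [|i] //=; rewrite nth_nil if_same.
Qed.

Lemma exec_call p l t v : runs p (get l 0) t v ->
  exists g, exec (call p) (st l nostore) t (st (put l 0 v) g).
Proof.
case=> s' E <-.
have aI : injective away by move=> [|i] [|j]; rewrite /away /=; lia.
have [|u [Eu ou nu]] := exec_ren aI E (u := st l nostore).
  by move=> [|i]; rewrite /away /st //= addnC.
exists u; rewrite (_ : st _ u = u) //; apply: functional_extensionality => i.
rewrite /st; case: ltnP => // lti; rewrite get_put.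
case: eqP => [->|/eqP i0]; first by rewrite -(ou 0).
by rewrite nu /st ?lti // => -[|j]; rewrite /away /=; lia.
Qed.

(** A called program needs a clean work space and leaves unknown contents there. Hence the start
    from [nostore] and a final store known on the output stack only; what precedes or follows the
    call is a [pt] machine, indifferent to the work space. *)
Definition rt X (D : X -> Prop) (sz : X -> nat) p s (out : X -> seq symbol) :=
  exists c, forall x, D x -> exists2 s', ok p (st (s x) nostore) s' (pbound (sz x) c) &
    s' 0 = out x.

Section Results.
Variables (X : Type) (D : X -> Prop) (sz : X -> nat).
Implicit Types (s : X -> seq (seq symbol)) (out inp : X -> seq symbol).

Lemma rt_poly_time p inp out : rt D sz p (fun x => [:: inp x]) out -> poly_time D sz inp out.
Proof.
move=> [c H]; exists p, c => x Dx; have [s' [t E le] e] := H x Dx.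
by exists t => //; exists s' => //; rewrite -st_init.
Qed.

Lemma rt_of_pt p s s' out : pt D sz p s s' -> (forall x, D x -> get (s' x) 0 = out x) ->
  rt D sz p s out.
Proof.
move=> [c H] e; exists c => x Dx; exists (st (s' x) nostore); first exact: H.
by rewrite -e.
Qed.

Lemma rt_polyb b p s out : polyb D sz b ->
  (forall x, D x -> exists2 s', ok p (st (s x) nostore) s' (b x) & s' 0 = out x) ->
  rt D sz p s out.
Proof.
move=> [c Hc] H; exists c => x Dx; have [s' [t E le] e] := H x Dx.
by exists s' => //; exists t => //; apply: leq_trans le (Hc x Dx).
Qed.

Lemma rt_seq p q s1 s2 out : pt D sz p s1 s2 -> rt D sz q s2 out -> rt D sz (Seq p q) s1 out.
Proof.
move=> [c Hp] [d Hq].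
apply: (@rt_polyb (fun x => pbound (sz x) c + pbound (sz x) d)) => [|x Dx].
  by apply: polyb_add; [exists c | exists d].
have [t1 E1 le1] := Hp x nostore Dx; have [s' [t2 E2 le2] e] := Hq x Dx.
by exists s' => //; exists (t1 + t2); [apply: exec_seq E1 E2 | rewrite leq_add].
Qed.

Lemma rt_case r k s out : r < 16 ->
  (forall o, rt (fun x => D x /\ ohead (get (s x) r) = o) sz (k o) s out) ->
  rt D sz (Case r k) s out.
Proof.
move=> ltr H.
have [c0 H0] := H None; have [c1 H1] := H (Some None).
have [c2 H2] := H (Some (Some true)); have [c3 H3] := H (Some (Some false)).
apply: (@rt_polyb (fun x => (pbound (sz x) (c0 + c1 + c2 + c3)).+1)) => [|x Dx].
  by apply: polyb_S; exists (c0 + c1 + c2 + c3).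
suff [s' [t E le] e] : exists2 s', ok (k (ohead (get (s x) r))) (st (s x) nostore) s'
    (pbound (sz x) (c0 + c1 + c2 + c3)) & s' 0 = out x.
  by exists s' => //; exists t.+1 => //; apply: exec_case; rewrite st_lt.
case eo: (ohead _) => [[[|]|]|].
- have [s' [t E le] e] := H2 x (conj Dx eo); exists s' => //; exists t => //.
  by apply: leq_trans le (pbound_mono _ _); lia.
- have [s' [t E le] e] := H3 x (conj Dx eo); exists s' => //; exists t => //.
  by apply: leq_trans le (pbound_mono _ _); lia.
- have [s' [t E le] e] := H1 x (conj Dx eo); exists s' => //; exists t => //.
  by apply: leq_trans le (pbound_mono _ _); lia.
have [s' [t E le] e] := H0 x (conj Dx eo); exists s' => //; exists t => //.
by apply: leq_trans le (pbound_mono _ _); lia.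
Qed.

Lemma rt_call p s out b : polyb D sz b ->
  (forall x, D x -> exists2 t, runs p (get (s x) 0) t (out x) & t <= b x) ->
  rt D sz (call p) s out.
Proof.
move=> Pb H; apply: (rt_polyb Pb) => x Dx; have [t R le] := H x Dx.
have [g E] := exec_call R; exists (st (put (s x) 0 (out x)) g); first by exists t.
by rewrite st_lt // get_put eqxx.
Qed.

(* The answer of [p] need not be a function of [x]; [Y] ranges over the possible answers. *)
Lemma rt_call_pt Y (ans : Y -> seq symbol) (good : X -> Y -> Prop) p q s
    (s' : X * Y -> seq (seq symbol)) b out :
  polyb D sz b ->
  (forall x, D x -> exists t y, [/\ runs p (get (s x) 0) t (ans y), t <= b x & good x y]) ->
  polyb D sz (fun x => size (get (s x) 0)) ->
  (forall d : X -> nat, polyb D sz d ->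
    pt (fun xy => [/\ D xy.1, good xy.1 xy.2 & size (ans xy.2) <= d xy.1])
       (fun xy => sz xy.1) q (fun xy => put (s xy.1) 0 (ans xy.2)) s') ->
  (forall x y, D x -> good x y -> get (s' (x, y)) 0 = out x) ->
  rt D sz (Seq (call p) q) s out.
Proof.
move=> Pb H Ps Hq e.
have [c {}Hq] := Hq _ (polyb_add Ps Pb).
apply: (@rt_polyb (fun x => b x + pbound (sz x) c)) => [|x Dx].
  by apply: polyb_add => //; exists c.
have [t [y [R le gd]]] := H x Dx; have [g E] := exec_call R.
(* The answer is no longer than the input plus the running time, so q may be analysed with a
   polynomial bound d on its size. *)
have szy : size (ans y) <= size (get (s x) 0) + b x.
  case: R => u Eu <-; apply: leq_trans (exec_size Eu 0) _.
  by rewrite leq_add2l.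
have [t2 E2 le2] := Hq (x, y) g (And3 Dx gd szy).
exists (st (s' (x, y)) g); last by rewrite st_lt //; apply: e.
by exists (t + t2); [apply: exec_seq E E2 | rewrite leq_add].
Qed.

End Results.

(** Polynomial time adds only polynomially many symbols, so the length of an output needs no
    separate computation. *)
Lemma pt_size X (D : X -> Prop) sz p s s' r : r < 16 -> pt D sz p s s' ->
  polyb D sz (fun x => size (get (s x) r)) -> polyb D sz (fun x => size (get (s' x) r)).
Proof.
move=> ltr [c H] Pr.
apply: (polyb_le (b' := fun x => size (get (s x) r) + pbound (sz x) c)) => [x Dx|].
  have [t E le] := H x nostore Dx; have := exec_size E r.
  by rewrite !st_lt // => le'; apply: leq_trans le' _; rewrite leq_add2l.
by apply: polyb_add => //; exists c.
Qed.

(* A verifier may ignore its certificate. *)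
Lemma class_P_NP L : class_P L -> class_NP L.
Proof.
move=> [p [c Hp]]; exists (fun x _ => L x); last first.
  exists 0 => x; rewrite mul0n; split=> [Lx|[]//].
  by exists [::].
apply: (rt_poly_time (p := Seq readx (Seq (clr 0) (Seq (mv 1 0) (call p))))).
have P1 : polyb (fun=> True) (fun xy : word * word => size xy.1 + size xy.2) (fun xy => size xy.1).
  by apply: polyb_le (polyb_size _ _) => x _; rewrite leq_addr.
have P2 : polyb (fun=> True) (fun xy : word * word => size xy.1 + size xy.2) (fun xy => size xy.2).
  by apply: polyb_le (polyb_size _ _) => x _; rewrite leq_addl.
apply: (@rt_seq _ _ _ _ _ _ (fun xy => [:: map some xy.2 ++ [:: None]; None :: rev (map some xy.1)])).
  apply: pt_eq (pt_readx (fun xy => map some xy.2 ++ [:: None]) P1) => // x _.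
  by case=> [|[|i]]; rewrite /= ?nth_nil // /enc_words /= -!cats1 -!catA.
apply: rt_seq.
  apply: pt_clr => //=; apply: polyb_cat; last exact: polyb_const.
  exact: polyb_map.
apply: rt_seq.
  by apply: pt_mv => //=; apply: polyb_S; apply: polyb_rev; apply: polyb_map.
apply: (rt_call (b := fun xy => c * (size xy.1).+1 ^ c)) => /=.
  apply: polyb_mul; first exact: polyb_const.
  by apply: polyb_exp; apply: polyb_S.
move=> [x y] _ /=; have [t R le] := Hp x I; exists t => //.
by rewrite rev_cons revK /enc_words /= in R *; rewrite cats0 in R *.
Qed.

(** * The matroids *)

Section SparsePaving.
Local Open Scope fset_scope.
Variables (E : {fset nat}) (a : nat -> nat) (k t : nat) (good : {fset nat} -> bool).
Hypotheses (aI : {in E &, injective a}) (k_gt0 : 0 < k).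

Definition paving_indep (S : {fset nat}) :=
  (#|` S| < k) || (#|` S| == k) && ((\sum_(e <- S) a e != t) || good S).

Definition paving : {fset nat} * {fset {fset nat}} :=
  (E, [fset S in fpowerset E | paving_indep S]).

Lemma in_paving S : (S \in paving.2) = (S `<=` E) && paving_indep S.
Proof. by rewrite !inE /= fpowersetE. Qed.

Lemma paving_indep_card S : paving_indep S -> #|` S| <= k.
Proof. by case/orP => [/ltnW//|/andP[/eqP->]]. Qed.

(* Two distinct elements cannot both complete a (k-1)-set to weight t, so that the k-sets of
   weight t pairwise differ in more than one element. *)
Lemma paving_matroid : is_matroid paving.
Proof.
split.
- by rewrite in_paving fsub0set /paving_indep cardfs0 k_gt0.
- by move=> A; rewrite in_paving => /andP[].
- move=> A B AB; rewrite !in_paving => /andP[BE iB].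
  rewrite (fsubset_trans AB BE) /=.
  have [->//|neAB] := eqVneq A B.
  have lt : #|` A| < #|` B| by apply: fproper_ltn_card; rewrite fproperEneq neAB.
  by rewrite /paving_indep (leq_trans lt (paving_indep_card iB)).
move=> A B; rewrite !in_paving => /andP[AE iA] /andP[BE iB] ltAB.
have addE e : e \in B -> e |` A `<=` E.
  by move=> eB; rewrite fsubUset fsub1set AE (fsubsetP BE).
have cadd e : e \in B `\` A -> #|` e |` A| = #|` A|.+1.
  by rewrite inE => /andP[eA _]; rewrite cardfsU1 eA.
have [e0 e0BA] : exists e, e \in B `\` A.
  apply/fset0Pn; rewrite fsetD_eq0; apply/negP => /fsubset_leq_card; lia.
have e0B : e0 \in B by move: e0BA; rewrite inE => /andP[].
(* While the enlarged set has fewer than k elements, any element of B outside A will do. *)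
have := paving_indep_card iB; rewrite leq_eqVlt => /orP[/eqP Bk|ltBk]; last first.
  exists e0 => //; rewrite in_paving addE // /paving_indep cadd //.
  by rewrite (leq_ltn_trans ltAB ltBk).
have [Ak|ltAk] := eqVneq #|` A|.+1 k; last first.
  exists e0 => //; rewrite in_paving addE // /paving_indep cadd //.
  by rewrite ltn_neqAle ltAk -Bk ltAB.
have sumU e : e \in B `\` A -> \sum_(i <- e |` A) a i = (a e + \sum_(i <- A) a i)%N.
  by rewrite inE => /andP[eA _]; rewrite big_fsetU1.
(* Now B has k elements and A has k - 1. If B offers a second new element, injectivity of a lets at
   most one of the two complete A to weight t; otherwise adding e0 to A gives B itself. *)
have [e1 | no1] := pickP (fun e : B => (val e \notin A) && (val e != e0)).
  move=> /andP[e1A e10].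
  have e1BA : val e1 \in B `\` A by rewrite inE e1A (valP e1).
  have [s0|s0] := eqVneq (\sum_(i <- e0 |` A) a i) t; last first.
    by exists e0 => //; rewrite in_paving addE // /paving_indep cadd // Ak eqxx s0 orbT.
  exists (val e1) => //; rewrite in_paving addE ?(valP e1) // /paving_indep cadd // Ak eqxx /=.
  suff -> : \sum_(i <- val e1 |` A) a i != t by rewrite orbT.
  apply: contra e10 => /eqP s1; apply/eqP/aI; rewrite ?(fsubsetP BE) ?(valP e1) //.
  by apply/eqP; rewrite -(eqn_add2r (\sum_(i <- A) a i)) -!sumU // s0 s1.
have eB : e0 |` A = B.
  have sBA : B `<=` e0 |` A.
    apply/fsubsetP => e eB; rewrite !inE.
    by have := no1 [` eB]; rewrite /=; case: eqP => //= _; case: (e \in A).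
  by apply/esym/eqP; rewrite eqEfcard sBA cadd // Ak Bk.
by exists e0 => //; rewrite eB in_paving BE.
Qed.

End SparsePaving.

(** * Powers of two and the matroid family *)

Lemma enc_nat_double n : 0 < n -> enc_nat (2 * n) = false :: enc_nat n.
Proof.
elim: n => // -[|n] IH _ //.
have -> : 2 * n.+2 = (2 * n.+1).+2 by lia.
by rewrite (enc_natS (2 * n.+1).+1) (enc_natS (2 * n.+1)) IH // (enc_natS n.+1).
Qed.

Lemma enc_nat_exp2 i : enc_nat (2 ^ i) = rcons (nseq i false) true.
Proof. by elim: i => // i IH; rewrite expnS enc_nat_double ?expn_gt0 // IH. Qed.

Definition blen (e : nat) := size (enc_nat e).

Lemma blen_exp2 i : blen (2 ^ i) = i.+1.
Proof. by rewrite /blen enc_nat_exp2 size_rcons size_nseq. Qed.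

(* On powers of two the bit length is the index plus one and the binary notation is unary, so
   that a machine adds up weights by counting symbols. *)
Section Family.
Variables (c : nat) (V : word -> word -> bool).
Implicit Types x y : word.

Definition cert_bound x := c * (size x).+1 ^ c.
(* One more than the length of certificates, so that the rank is positive even if c = 0. *)
Definition npos x := (cert_bound x).+1.
Definition rank x := 2 * npos x.
Definition nelt x := 6 * npos x.
(** There are [npos x] pairs of an element and its mirror image, each of weight [nelt x + 1]. *)
Definition target x := nelt x * npos x + npos x.
Definition ground x : {fset nat} := [fset e in [seq 2 ^ i | i <- iota 0 (nelt x)]]%fset.

(** A cyclic permutation of the three symbols: [digit i] depends on i modulo 3 only, and a machine
    finds it by one rotation per bit. *)
Definition turn (a : symbol) : symbol :=
  match a with Some false => Some true | Some true => None | None => Some false end.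
Definition digit i : symbol := iter i turn (Some false).
(** Defined on all sets: the [cert_bound x] smallest elements are read and blanks dropped, which
    admits certificates shorter than the bound. In a code these are the low elements of all
    positions but the last. *)
Definition decode x (S : {fset nat}) : word :=
  pmap id [seq digit (blen e).-1 | e <- take (cert_bound x) (elements S)].

Definition NPmatroid x := paving (ground x) blen (rank x) (target x) (fun S => V x (decode x S)).

Lemma in_fset_of (s : seq nat) e : (e \in [fset e in s]%fset) = (e \in s).
Proof. by rewrite !inE. Qed.

Lemma in_ground x e : reflect (exists2 i, i < nelt x & e = 2 ^ i) (e \in ground x).
Proof.
rewrite in_fset_of; apply: (iffP mapP) => [[i]|[i lt ->]].
  by rewrite mem_iota add0n => lt ->; exists i.
by exists i => //; rewrite mem_iota.
Qed.

Lemma NPmatroidP x : is_matroid (NPmatroid x).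
Proof.
apply: paving_matroid => //.
by move=> _ _ /in_ground[i _ ->] /in_ground[j _ ->]; rewrite !blen_exp2 => -[->].
Qed.

Lemma elements_perm (S : {fset nat}) : perm_eq (elements S) (enum_fset S).
Proof. by rewrite perm_sort. Qed.

Lemma elements_of (s : seq nat) : sorted ltn s -> elements [fset e in s]%fset = s.
Proof.
move=> ss; rewrite -[RHS](sorted_sort leq_trans); last exact: (sub_sorted (fun i j => @ltnW i j)).
apply/(perm_sortP leq_total leq_trans anti_leq).
apply: uniq_perm; rewrite ?fset_uniq //; first by apply: sorted_uniq ss; [exact: ltn_trans|exact: ltnn].
by move=> e; rewrite in_fset_of.
Qed.

Lemma elements_ground x : elements (ground x) = [seq 2 ^ i | i <- iota 0 (nelt x)].
Proof.
apply: elements_of; rewrite sorted_map; apply: (sub_sorted _ (iota_ltn_sorted _ _)).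
by move=> i j /=; rewrite ltn_exp2l.
Qed.

(* One of three low elements per position codes a digit (the third one a blank), and each low
   element i is balanced by its mirror image, so that the weights of all codes agree. *)
Definition low y i := 3 * i + nth 2 (map nat_of_bool y) i.
Definition lows x y := [seq low y i | i <- iota 0 (npos x)].
Definition code_seq x y := lows x y ++ rev [seq nelt x - i.+1 | i <- lows x y].
Definition code x y : {fset nat} := [fset e in [seq 2 ^ i | i <- code_seq x y]]%fset.

(** Each position chooses among three indices of its own. Past the end of y the default 2 is the
    blank digit. *)
Lemma low_bound y i : 3 * i <= low y i < 3 * i.+1.
Proof.
rewrite /low; have : nth 2 (map nat_of_bool y) i <= 2.
  by elim: y i => [|b y IH] [|i] //=; case: b.
lia.
Qed.

Lemma lows_lt x y : all (fun i => i < 3 * npos x) (lows x y).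
Proof.
apply/allP => j /mapP[i]; rewrite mem_iota => /andP[_ lt] ->.
have := low_bound y i; lia.
Qed.

Lemma lows_sorted x y : sorted ltn (lows x y).
Proof.
rewrite sorted_map; apply: (sub_sorted _ (iota_ltn_sorted _ _)) => i j /= lt.
have := low_bound y i; have := low_bound y j; lia.
Qed.

(** Low elements lie in the lower half of the ground set and mirror images in the upper half, where
    [rev] makes up for the reversal of order. Thus [decode] meets the low elements first. *)
Lemma code_seq_sorted x y : sorted ltn (code_seq x y).
Proof.
have lt := lows_lt x y; have := lows_sorted x y.
rewrite !(sorted_pairwise ltn_trans) pairwise_cat => pw; apply/and3P; split=> //.
  apply/allrelP => i j /(allP lt) lti; rewrite mem_rev => /mapP[l /(allP lt) ltl ->].
  by move: lti ltl; rewrite /nelt; lia.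
rewrite -(sorted_pairwise ltn_trans) rev_sorted sorted_map sorted_pairwise; last first.
  by move=> i j l /= h1 h2; exact: ltn_trans h2 h1.
apply: sub_in_pairwise lt pw => i j; rewrite !unfold_in /= /nelt; lia.
Qed.

Lemma elements_code x y : elements (code x y) = [seq 2 ^ i | i <- code_seq x y].
Proof.
apply: elements_of; rewrite sorted_map; apply: (sub_sorted _ (code_seq_sorted _ _)).
by move=> i j /=; rewrite ltn_exp2l.
Qed.

Lemma card_code x y : #|` code x y|%fset = rank x.
Proof.
rewrite -(perm_size (elements_perm _)) elements_code size_map size_cat size_rev !size_map.
by rewrite size_iota /rank addnn mul2n.
Qed.

(** An index i and its mirror image n - i - 1 together contribute n + 1. *)
Lemma sum_mirror (s : seq nat) n : all (fun i => i < n) s ->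
  \sum_(i <- s ++ rev [seq n - i.+1 | i <- s]) i.+1 = n.+1 * size s.
Proof.
move=> lt; rewrite big_cat /= [X in _ + X](perm_big [seq n - i.+1 | i <- s]) /=; last first.
  by rewrite perm_rev.
rewrite big_map -big_split /= (eq_big_seq (fun=> n.+1)) => [|i /(allP lt)]; last by lia.
by rewrite big_const_seq count_predT iter_addn_0.
Qed.

Lemma sum_code x y : \sum_(e <- code x y) blen e = target x.
Proof.
rewrite -(perm_big _ (elements_perm (code x y))) elements_code big_map.
under eq_bigr do rewrite blen_exp2.
rewrite sum_mirror; first by rewrite size_map size_iota /target mulSn addnC.
by apply: sub_all (lows_lt x y) => i; rewrite /nelt; lia.
Qed.

Lemma code_sub x y : (code x y `<=` ground x)%fset.
Proof.
apply/fsubsetP => e; rewrite in_fset_of => /mapP[i ii ->]; apply/in_ground; exists i => //.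
move: ii; rewrite mem_cat => /orP[/(allP (lows_lt x y))|]; first by rewrite /nelt; lia.
by rewrite mem_rev => /mapP[l _ ->]; rewrite /nelt /npos; lia.
Qed.

Lemma digit3 i j : digit (3 * i + j) = digit j.
Proof. by rewrite /digit addnC iterD; congr iter; elim: i => // i IH; rewrite mulnS iterD IH. Qed.

Lemma pmap_digits M y : size y <= M ->
  pmap id [seq digit (nth 2 (map nat_of_bool y) i) | i <- iota 0 M] = y.
Proof.
elim: M y => [|M IH] [|b y] //= le; rewrite -[1]addn0 iotaDl -map_comp.
  by rewrite (eq_map (g := fun i => digit (nth 2 (map nat_of_bool [::]) i))) ?IH // => i /=; rewrite !nth_nil.
by rewrite (eq_map (g := fun i => digit (nth 2 (map nat_of_bool y) i))) // IH //; case: b.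
Qed.

(** The digits of the elements read spell y followed by blanks. *)
Lemma decode_code x y : size y <= cert_bound x -> decode x (code x y) = y.
Proof.
move=> le; rewrite /decode elements_code -map_take takel_cat; last first.
  by rewrite size_map size_iota.
rewrite -map_take take_iota (minn_idPl _) // -!map_comp.
rewrite (eq_map (g := fun i => digit (nth 2 (map nat_of_bool y) i))) ?pmap_digits //.
by move=> i /=; rewrite blen_exp2 /low digit3.
Qed.

(** Since S is arbitrary, whatever exceptional set turns out independent yields a certificate of
    admissible length. *)
Lemma size_decode x S : size (decode x S) <= cert_bound x.
Proof.
rewrite /decode size_pmap; apply: leq_trans (count_size _ _) _.
by rewrite size_map size_take; case: ltnP => // /ltnW.
Qed.

End Family.

Lemma nposE c x : npos c x = (cert_bound c x).+1. Proof. by []. Qed.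
Lemma rankE c x : rank c x = 2 * npos c x. Proof. by []. Qed.
Lemma neltE c x : nelt c x = 6 * npos c x. Proof. by []. Qed.
Lemma targetE c x : target c x = nelt c x * npos c x + npos c x. Proof. by []. Qed.

(** * The decoder *)

Section Bounds.
Variables (X : Type) (D : X -> Prop) (w : X -> word) (c : nat).
Notation polyw := (polyb D (fun x => size (w x))).

Lemma polyb_cert_bound : polyw (fun x => cert_bound c (w x)).
Proof.
apply: polyb_mul; first exact: polyb_const.
by apply: polyb_exp; apply: polyb_S; apply: polyb_size.
Qed.

Lemma polyb_npos : polyw (fun x => npos c (w x)).
Proof. by apply: polyb_S; apply: polyb_cert_bound. Qed.

Lemma polyb_rank : polyw (fun x => rank c (w x)).
Proof. by apply: polyb_mul; [apply: polyb_const | apply: polyb_npos]. Qed.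

Lemma polyb_nelt : polyw (fun x => nelt c (w x)).
Proof. by apply: polyb_mul; [apply: polyb_const | apply: polyb_npos]. Qed.

Lemma polyb_target : polyw (fun x => target c (w x)).
Proof.
apply: polyb_add; last exact: polyb_npos.
by apply: polyb_mul; [apply: polyb_nelt | apply: polyb_npos].
Qed.

End Bounds.

(* Otherwise simplification would unfold the unary counters below. *)
Opaque npos rank nelt target.

Lemma nseq_cons T n (a : T) : a :: nseq n a = nseq n.+1 a. Proof. by []. Qed.
Lemma nseq_cat T n m (a : T) : nseq n a ++ nseq m a = nseq (n + m) a.
Proof. by rewrite nseqD. Qed.
Definition unaryE T := (cats0, @size_nseq T, @nseq_cons T, @nseq_cat T).

Ltac pb := repeat first
  [ assumption | apply: polyb_cert_bound | apply: polyb_npos | apply: polyb_rank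
  | apply: polyb_nelt | apply: polyb_target | apply: polyb_nseq | apply: polyb_cat
  | apply: polyb_rev | apply: polyb_map | apply: polyb_size
  | apply: polyb_const | apply: polyb_S
  | apply: polyb_mul | apply: polyb_add ].

Notation "p ;; q" := (Seq p q) (at level 61, right associativity).

Definition pushes n r := iter n (fun p => Seq p (Push r None)) Skip.
(** With its separator, stack 1 has length [(size x).+1], the base of the power; each round
    multiplies by it. *)
Fixpoint pow_prog c j :=
  if j is j'.+1 then pow_prog c j' ;; mulu None 2 1 7 8 9 ;; clr 2 ;; mv 7 2 else pushes c 2.
(* Register 1 holds the input word, reversed and with its separator; registers 2 to 6 receive the
   parameters cert_bound, npos, rank, nelt and target in unary. *)
Definition params c :=
  pow_prog c c ;; addu None 2 3 7 ;; Push 3 None ;; addu None 3 4 7 ;; addu None 3 4 7 ;;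
  addu None 3 5 7 ;; addu None 3 5 7 ;; addu None 3 5 7 ;;
  addu None 3 5 7 ;; addu None 3 5 7 ;; addu None 3 5 7 ;;
  mulu None 5 3 6 7 8 ;; addu None 3 6 7.

Section Params.
Variables (X : Type) (D : X -> Prop) (w : X -> word) (c : nat).
Notation ptw := (pt D (fun x => size (w x))).
Variables r0 r1 : X -> seq symbol.
Hypothesis size_r1 : forall x, D x -> size (r1 x) = (size (w x)).+1.

Lemma pt_pushes n : ptw (pushes n 2) (fun x => [:: r0 x; r1 x])
  (fun x => [:: r0 x; r1 x; nseq n None]).
Proof.
elim: n => [|n IH]; first by apply: pt_eqr; [apply: pt_skip|lits].
apply: pt_seq IH _; apply: (pt_eqr (pt_push _ _ _ _ _)) => //.
Qed.

Lemma pt_pow_prog j : ptw (pow_prog c j) (fun x => [:: r0 x; r1 x])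
  (fun x => [:: r0 x; r1 x; nseq (c * (size (w x)).+1 ^ j) None]).
Proof.
elim: j => [|j IH] /=; first by apply: (pt_eqr (pt_pushes c)) => x _; rewrite expn0 muln1.
have P1 : polyb D (fun x => size (w x)) (fun x => size (r1 x)).
  by apply: polyb_le (polyb_S (polyb_size _ _)) => x /size_r1 ->.
have P2 : polyb D (fun x => size (w x)) (fun x => c * (size (w x)).+1 ^ j).
  by apply: polyb_mul; [pb | apply: polyb_exp; pb].
apply: (pt_seq IH).
apply: pt_seq; first by apply: pt_mulu => //=; pb.
rewrite /=; apply: pt_seq; first by apply: pt_clr => //=; pb.
rewrite /=; apply: (pt_eqr (pt_mv _ _ _ _)) => //=.
  by pb.
by move=> x Dx; rewrite !cats0 size_nseq size_r1 // rev_nseq expnSr mulnA; lits.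
Qed.

Lemma pt_params : ptw (params c) (fun x => [:: r0 x; r1 x])
  (fun x => [:: r0 x; r1 x; nseq (cert_bound c (w x)) None; nseq (npos c (w x)) None;
    nseq (rank c (w x)) None; nseq (nelt c (w x)) None; nseq (target c (w x)) None]).
Proof.
apply: (pt_seq (pt_pow_prog c)); rewrite -/(cert_bound c _).
have Pc : polyb D (fun x => size (w x)) (fun x => c * (size (w x)).+1 ^ c).
  exact: polyb_cert_bound.
apply: pt_seq; first by apply: pt_addu => //=; pb.
rewrite /=; apply: pt_seq; first by apply: pt_push.
rewrite /=; apply: pt_seq; first by apply: pt_addu => //=; pb.
rewrite /=; apply: pt_seq; first by apply: pt_addu => //=; pb.
do 6!(rewrite /=; apply: pt_seq; first by apply: pt_addu => //=; pb).
rewrite /=; apply: pt_seq; first by apply: pt_mulu => //=; pb.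
rewrite /=; apply: (pt_eqr (pt_addu _ _ _ _ _ _ _)) => //=; first by pb.
move=> x Dx; rewrite -/(cert_bound c (w x)) !unaryE; lits; congr nseq.
all: rewrite ?targetE ?neltE ?rankE ?nposE; lia.
Qed.
End Params.

Lemma enc_words_cons w ws : enc_words (w :: ws) = map some w ++ None :: enc_words ws.
Proof. by rewrite /enc_words /= cat_rcons. Qed.

Lemma enc_words_cat ws ws' : enc_words (ws ++ ws') = enc_words ws ++ enc_words ws'.
Proof. by rewrite /enc_words map_cat flatten_cat. Qed.

(** Stack 0 is written from its end, hence from the largest element down; the counter left on stack
    5 is the exponent, that is, the number of zeros to write. *)
Definition ground_prog c :=
  readx ;; params c ;;
  While 5 nonempty (Pop 5 ;; Push 0 None ;; Push 0 (Some true) ;; addu (Some false) 5 0 7).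

Lemma pt_read_params X (D : X -> Prop) (w : X -> word) (u : X -> seq symbol) c q s' out :
  rt D (fun x => size (w x)) q (fun x => [:: u x; None :: rev (map some (w x));
    nseq (cert_bound c (w x)) None; nseq (npos c (w x)) None;
    nseq (rank c (w x)) None; nseq (nelt c (w x)) None; nseq (target c (w x)) None]) out ->
  (forall x, D x -> s' x = [:: map some (w x) ++ None :: u x]) ->
  rt D (fun x => size (w x)) (readx ;; params c ;; q) s' out.
Proof.
move=> H e; apply: rt_seq.
  apply: pt_eq (pt_readx u (polyb_size _ _)) => // x Dx; rewrite e //; lits.
apply: rt_seq H; apply: pt_params => x _.
by rewrite /= size_rev size_map.
Qed.

Lemma enc_ground c x : enc_words (enc_set (ground c x)) =
  enc_words [seq enc_nat (2 ^ i) | i <- iota 0 (nelt c x)].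
Proof. by rewrite /enc_set elements_ground -map_comp. Qed.

Lemma ground_poly_time c : poly_time (fun _ : word => True) size
  (fun x => enc_words [:: x]) (fun x => enc_words (enc_set (ground c x))).
Proof.
apply: (rt_poly_time (p := ground_prog c)).
apply: (@pt_read_params word (fun=> True) id (fun=> [::])); last first.
  by move=> x _; rewrite enc_words_cons.
pose inv x i := [:: enc_words [seq enc_nat (2 ^ i) | i <- iota (nelt c x - i) i];
    None :: rev (map some x); nseq (cert_bound c x) None; nseq (npos c x) None;
    nseq (rank c x) None; nseq (nelt c x - i) None; nseq (target c x) None].
apply: (@rt_of_pt _ _ _ _ _ (fun x => inv x (nelt c x))); last first.
  by move=> x _; rewrite /= subnn enc_ground.
apply: (pt_while_list (inv := inv)) => //=.
- by pb.
- by move=> x _; rewrite size_nseq.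
- by move=> x i _; rewrite !size_nseq.
apply: pt_seq; first by apply: pt_pop.
rewrite /=; apply: pt_seq; first by apply: pt_push.
rewrite /=; apply: pt_seq; first by apply: pt_push.
apply: (pt_eqr (pt_addu _ _ _ _ _ _ _)) => //=.
  apply: (polyb_le (b' := fun xi => nelt c xi.1)) => [[x i] _|]; last by pb.
  by rewrite size_behead size_nseq /=; lia.
move=> [x i] [/= _]; rewrite size_nseq behead_nseq size_nseq /inv /= => lt.
have -> : nelt c x - i = (nelt c x - i.+1).+1 by lia.
by rewrite /inv /= enc_words_cons enc_nat_exp2 map_rcons map_nseq cat_rcons.
Qed.

(** * Counting elements and bits of a set *)

Definition dec r := Case r (fun o => if o is Some None then Pop r else Push r (Some true)).
(* What remains of nseq k None after n decrements; excess decrements are kept as true. *)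
Definition residue k n : seq symbol := if n <= k then nseq (k - n) None else nseq (n - k) (Some true).

Lemma residue0 k : residue k 0 = nseq k None.
Proof. by rewrite /residue leq0n subn0. Qed.

Lemma residueS k n : residue k n.+1 =
  if ohead (residue k n) is Some None then behead (residue k n) else Some true :: residue k n.
Proof.
rewrite /residue; case: (ltngtP n k) => [lt|lt|->].
- by have -> : k - n = (k - n.+1).+1 by lia.
- by rewrite subSn 1?ltnW //; case: (n - k) => // ?.
by rewrite subnn subSnn.
Qed.

(** The topmost symbol alone tells how n compares with k. *)
Lemma ohead_residue k n : ohead (residue k n) =
  if n == k then None else if n < k then Some None else Some (Some true).
Proof.
rewrite /residue; case: (ltngtP n k) => [lt|lt|->]; last by rewrite subnn.
  by have -> : k - n = (k - n.+1).+1 by lia.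
by have -> : n - k = (n - k.+1).+1 by lia.
Qed.

Lemma pt_dec X (D : X -> Prop) sz r s (k n : X -> nat) : r < 16 ->
  (forall x, D x -> get (s x) r = residue (k x) (n x)) ->
  pt D sz (dec r) s (fun x => put (s x) r (residue (k x) (n x).+1)).
Proof.
move=> ltr e; apply: pt_case => // o.
have {}e x : D x /\ ohead (get (s x) r) = o -> residue (k x) (n x).+1 =
    if o is Some None then behead (get (s x) r) else Some true :: get (s x) r.
  by case=> Dx <-; rewrite residueS e.
case: o e => [[b|]|] e.
- by apply: (pt_eqr (pt_push _ _ _ _ _)) => // x /e ->.
- by apply: (pt_eqr (pt_pop _ _ _ _)) => // x /e ->.
- by apply: (pt_eqr (pt_push _ _ _ _ _)) => // x /e ->.
Qed.

(** Separators are counted against the rank on stack 4 and bits against the target weight on stack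
    6; stack 8 keeps the words, reversed. *)
Definition count_words := While 0 nonempty
  (Case 0 (fun o => if o is Some None then dec 4 else dec 6) ;; xfer 0 8).

Lemma pt_count_words X (D : X -> Prop) sz (u r1 r2 r3 r5 : X -> seq symbol) (k t : X -> nat) :
  polyb D sz (fun x => size (u x)) ->
  pt D sz count_words (fun x => [:: u x; r1 x; r2 x; r3 x; nseq (k x) None; r5 x; nseq (t x) None])
    (fun x => [:: [::]; r1 x; r2 x; r3 x; residue (k x) (count_mem None (u x)); r5 x;
      residue (t x) (count (predC1 None) (u x)); [::]; rev (u x)]).
Proof.
move=> Pu.
pose inv x i := [:: drop i (u x); r1 x; r2 x; r3 x; residue (k x) (count_mem None (take i (u x)));
  r5 x; residue (t x) (count (predC1 None) (take i (u x))); [::]; rev (take i (u x))].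
apply: (pt_while_list (inv := inv)) => //=.
- by move=> x _; rewrite /inv drop0 take0 /= !residue0; lits.
- by move=> x _; rewrite /inv drop_size take_size; lits.
- by move=> x i _; rewrite size_drop.
pose mid (xi : X * nat) := let: (x, i) := xi in
  [:: drop i (u x); r1 x; r2 x; r3 x; residue (k x) (count_mem None (take i.+1 (u x)));
  r5 x; residue (t x) (count (predC1 None) (take i.+1 (u x))); [::]; rev (take i (u x))].
apply: (pt_seq (s2 := mid)).
  apply: pt_case => // o.
  have H p x i : (D x /\ i < size (u x)) /\ ohead (drop i (u x)) = o ->
      exists2 a, o = Some a & count p (take i.+1 (u x)) = p a + count p (take i (u x)).
    case=> [[_ lt]]; rewrite (drop_nth None lt) (take_nth None lt) /= => <-.
    by eexists; [reflexivity | rewrite -cats1 count_cat /= addn0 addnC].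
  have pt6 b : o = Some (Some b) -> pt (fun xi => (D xi.1 /\ xi.2 < size (u xi.1)) /\
      ohead (drop xi.2 (u xi.1)) = o) (fun xi => sz xi.1) (dec 6) (fun xi => inv xi.1 xi.2) mid.
    move=> eo; apply: (pt_eqr (pt_dec (r := 6) (k := fun xi => t xi.1)
      (n := fun xi => count (predC1 None) (take xi.2 (u xi.1))) _ _ _)) => // -[x i] /H e.
    rewrite /mid /inv /=; have [a] := e (predC1 None); have [a'] := e (pred1 None).
    by rewrite eo => -[<-] -> [<-] ->; rewrite add0n add1n.
  case: o H pt6 => [[b|]|] H pt6.
  - exact: pt6.
  - apply: (pt_eqr (pt_dec (r := 4) (k := fun xi => k xi.1)
      (n := fun xi => count_mem None (take xi.2 (u xi.1))) _ _ _)) => // -[x i] /H e.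
    rewrite /mid /inv /=; have [a] := e (predC1 None); have [a'] := e (pred1 None).
    by case=> <- -> [<-] ->; rewrite add0n add1n.
  (* The loop runs on a nonempty stack, so this branch has an empty domain. *)
  - by exists 0 => -[x i] g /(H xpredT)[].
apply: (pt_eqr (pt_xfer _ _ _ _ _ _)) => // -[x i] [/= _ lt].
by rewrite /inv /= (drop_nth None lt) [take _.+1 _](take_nth None lt) rev_rcons.
Qed.

Lemma polyb_sub X (D D' : X -> Prop) sz b : (forall x, D x -> D' x) -> polyb D' sz b -> polyb D sz b.
Proof. by move=> DD [c H]; exists c => x /DD; apply: H. Qed.

Lemma pbound_monol z z' c : z <= z' -> pbound z c <= pbound z' c.
Proof. by case: c => // c le; rewrite leq_mul // leq_exp2r. Qed.

Lemma rt_sub X (D D' : X -> Prop) sz p s out : (forall x, D x -> D' x) ->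
  rt D' sz p s out -> rt D sz p s out.
Proof. by move=> DD [c H]; exists c => x /DD; apply: H. Qed.

(** * Reading a digit off a power of two *)

Definition isfalse (o : option symbol) : bool := if o is Some (Some false) then true else false.
Definition rot_prog := Case 9 (fun o => Seq (Pop 9) (Push 9 (turn (odflt None o)))).
(** The symbol on stack 9 is rotated once per zero of the word and removed if it ends up as a
    blank. *)
Definition digit_prog :=
  Push 9 (Some false) ;; While 0 isfalse (Pop 0 ;; rot_prog) ;; Pop 0 ;; Pop 0 ;;
  Case 9 (fun o => if o is Some None then Pop 9 else Skip).

Section Digit.
Variables (X : Type) (D : X -> Prop) (sz : X -> nat).
Variables (r1 r2 r3 r4 r5 r6 r7 r8 : X -> seq symbol).

Lemma pt_rot u a y :
  pt D sz rot_prog (fun x => [:: u x; r1 x; r2 x; r3 x; r4 x; r5 x; r6 x; r7 x; r8 x; a x :: y x])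
    (fun x => [:: u x; r1 x; r2 x; r3 x; r4 x; r5 x; r6 x; r7 x; r8 x; turn (a x) :: y x]).
Proof.
apply: pt_case => // o; apply: pt_seq; first by apply: pt_pop.
by apply: (pt_eqr (pt_push _ _ _ _ _)) => // x [_ /= <-].
Qed.

End Digit.

Section Digit.
Variables (X : Type) (D : X -> Prop) (sz : X -> nat).
Variables (r1 r2 r3 r4 r5 r6 r7 r8 : X -> seq symbol).

Lemma pt_digit (l : X -> nat) u y : polyb D sz l ->
  pt D sz digit_prog
    (fun x => [:: map some (rcons (nseq (l x) false) true) ++ None :: u x; r1 x; r2 x; r3 x; r4 x;
      r5 x; r6 x; r7 x; r8 x; map some (y x)])
    (fun x => [:: u x; r1 x; r2 x; r3 x; r4 x; r5 x; r6 x; r7 x; r8 x;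
      map some (if digit (l x) is Some b then b :: y x else y x)]).
Proof.
move=> Pl; apply: pt_seq; first by apply: pt_push.
pose inv x i := [:: map some (rcons (nseq (l x - i) false) true) ++ None :: u x; r1 x; r2 x; r3 x;
  r4 x; r5 x; r6 x; r7 x; r8 x; digit i :: map some (y x)].
rewrite /=; apply: (pt_seq (s2 := fun x => inv x (l x))).
  apply: (pt_while (n := l) (inv := inv)) => //=.
  - by move=> x _; rewrite /inv subn0.
  - by move=> x i _ lt; have -> : l x - i = (l x - i.+1).+1 by lia.
  - by move=> x _; rewrite subnn.
  apply: pt_seq; first by apply: pt_pop.
  apply: (pt_eqr (pt_rot _ _ _ _ _ _ _ _ _ _ _ _ _)) => // -[x i] [/= _ lt].
  by rewrite /inv /=; have -> : l x - i = (l x - i.+1).+1 by lia.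
apply: pt_seq; first by apply: pt_pop.
rewrite /=; apply: pt_seq; first by apply: pt_pop.
rewrite /=; apply: pt_case => // -[[b|]|].
- apply: (pt_eqr (pt_skip _ _ _)) => // x [_ /= [e]].
  by rewrite subnn /= e.
- apply: (pt_eqr (pt_pop _ _ _ _)) => // x [_ /= [e]].
  by rewrite subnn /= e.
by exists 0 => x g [].
Qed.

End Digit.

Lemma mem_NPmatroid c V x S : S \in (NPmatroid c V x).2 =
  (S `<=` ground c x)%fset && ((#|` S|%fset < rank c x) ||
   (#|` S|%fset == rank c x) && ((\sum_(e <- S) blen e != target c x) || V x (decode c x S))).
Proof. exact: in_paving. Qed.

Lemma count_None_enc ws : count_mem None (enc_words ws) = size ws.
Proof.
elim: ws => // w ws IH; rewrite enc_words_cons count_cat /= IH.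
by rewrite (_ : count_mem None _ = 0) //; elim: w.
Qed.

Lemma count_bits_enc ws : count (predC1 None) (enc_words ws) = \sum_(w <- ws) size w.
Proof.
elim: ws => [|w ws IH]; first by rewrite big_nil.
rewrite enc_words_cons count_cat /= IH big_cons; congr addn.
by elim: w => //= b w ->.
Qed.

Lemma size_enc_set S : size (enc_set S) = #|` S|%fset.
Proof. by rewrite size_map (perm_size (elements_perm S)). Qed.

Lemma sum_enc_set S : \sum_(w <- enc_set S) size w = \sum_(e <- S) blen e.
Proof. by rewrite big_map (perm_big _ (elements_perm S)). Qed.

Lemma size_enc_words ws : size (enc_words ws) = size ws + \sum_(w <- ws) size w.
Proof.
rewrite -count_bits_enc -(count_None_enc ws) -(count_predC (pred1 None)).
by congr addn; apply: eq_count.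
Qed.

Lemma card_ground c x : #|` ground c x|%fset = nelt c x.
Proof. by rewrite -(perm_size (elements_perm _)) elements_ground size_map size_iota. Qed.

Lemma sum_blen_le c x (S : {fset nat}) : (S `<=` ground c x)%fset ->
  \sum_(e <- S) blen e <= #|` S|%fset * nelt c x.
Proof.
move=> sub; apply: (@leq_trans (\sum_(e <- S) nelt c x)).
  rewrite big_seq [leqRHS]big_seq leq_sum // => e /(fsubsetP sub)/in_ground[i lt ->].
  by rewrite blen_exp2.
by rewrite big_const_seq count_predT iter_addn_0 mulnC.
Qed.

(** The time for a membership query is measured in x alone, so the encoding of S must be bounded in
    terms of x. *)
Lemma size_enc_subset c x (S : {fset nat}) : (S `<=` ground c x)%fset ->
  size (enc_words (enc_set S)) <= nelt c x + nelt c x * nelt c x.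
Proof.
move=> sub; have le : #|` S|%fset <= nelt c x by rewrite -card_ground fsubset_leq_card.
rewrite size_enc_words size_enc_set sum_enc_set leq_add //.
by apply: leq_trans (sum_blen_le sub) _; rewrite leq_mul.
Qed.

Definition answer b := Push 0 (Some b).

(** Stack 2 limits the loop to [cert_bound] elements; the digits pile up reversed on stack 9, and
    the last transfers assemble the input of the verifier. *)
Definition decode_prog :=
  mv 8 0 ;; While 2 nonempty (Pop 2 ;; digit_prog) ;; clr 0 ;; Push 0 None ;; mv 9 0 ;; mv 1 0.

(** Cardinality and weight settle every set except those of exactly [rank] elements and weight
    [target]; only for these is the verifier run. *)
Definition member_prog c pV :=
  readx ;; params c ;; count_words ;;
  Case 4 (fun o => match o with
    | Some None => answer true
    | Some (Some _) => answer false
    | None => Case 6 (fun o => if o is Some _ then answer true else decode_prog ;; call pV)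
    end).

(** * Deciding independence *)

Section Decode.
Variables (c : nat).
Notation X := (word * {fset nat})%type.
Implicit Types q : X.

Definition dom q : Prop :=
  [/\ (q.2 `<=` ground c q.1)%fset, #|` q.2|%fset = rank c q.1 & \sum_(e <- q.2) blen e = target c q.1].

Notation bits q := (rev (map some q.1) : seq symbol).

Lemma pt_decode : pt dom (fun q => size q.1) decode_prog
  (fun q => [:: [::]; None :: bits q; nseq (cert_bound c q.1) None; nseq (npos c q.1) None; [::];
     nseq (nelt c q.1) None; [::]; [::]; rev (enc_words (enc_set q.2))])
  (fun q => [:: enc_words [:: q.1; decode c q.1 q.2]; [::]; [::]; nseq (npos c q.1) None; [::];
     nseq (nelt c q.1) None; [::]; [::]; [::]; [::]]).
Proof.
have Pu : polyb dom (fun q => size q.1) (fun q => size (enc_words (enc_set q.2))).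
  apply: polyb_le => [q [sub _ _]|]; first exact: size_enc_subset sub.
  by pb.
have encE q e : dom q -> e \in elements q.2 -> enc_nat e = rcons (nseq (blen e).-1 false) true.
  case=> sub _ _; rewrite (perm_mem (elements_perm _)) => /(fsubsetP sub)/in_ground[i _ ->].
  by rewrite blen_exp2 enc_nat_exp2.
(* The rank exceeds [cert_bound], so the loop never runs out of elements. *)
have sizeE q : dom q -> cert_bound c q.1 < size (elements q.2).
  by case=> _ e _; rewrite (perm_size (elements_perm _)) e rankE nposE; lia.
apply: pt_seq; first by apply: pt_mv => //=; pb.
pose y q i := pmap id [seq digit (blen e).-1 | e <- take i (elements q.2)].
pose inv q i := [:: enc_words (drop i (enc_set q.2)); None :: bits q;
  nseq (cert_bound c q.1 - i) None; nseq (npos c q.1) None; [::];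
  nseq (nelt c q.1) None; [::]; [::]; [::]; map some (rev (y q i))].
rewrite /=; apply: (pt_seq (s2 := fun q => inv q (cert_bound c q.1))).
  apply: (pt_while_list (inv := inv)) => //=.
  - by pb.
  - by move=> q Dq; rewrite /inv drop0 subn0 /y take0 cats0 revK; lits.
  - by move=> q _; rewrite size_nseq.
  - by move=> q i _; rewrite !size_nseq.
  apply: pt_seq; first by apply: pt_pop.
  pose l (qi : X * nat) := (blen (nth 0 (elements qi.1.2) qi.2)).-1.
  apply: pt_eq (pt_digit (l := l)
    (fun qi => None :: bits qi.1) (fun qi => nseq (cert_bound c qi.1.1 - qi.2.+1) None)
    (fun qi => nseq (npos c qi.1.1) None) (fun qi => [::])
    (fun qi => nseq (nelt c qi.1.1) None)
    (fun qi => [::]) (fun qi => [::]) (fun qi => [::])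
    (fun qi => enc_words (drop qi.2.+1 (enc_set qi.1.2))) (fun qi => rev (y qi.1 qi.2)) _) => /=.
  - move=> [q i] [/= Dq]; rewrite size_nseq behead_nseq subnS => lt.
    have lti := ltn_trans lt (sizeE q Dq).
    rewrite (drop_nth [::]) ?size_map // enc_words_cons (nth_map 0) //.
    by rewrite (encE q) ?mem_nth.
  - move=> [q i] [/= Dq]; rewrite size_nseq => lt.
    have lti := ltn_trans lt (sizeE q Dq).
    rewrite /inv /y (take_nth 0 lti) -cats1 map_cat pmap_cat rev_cat /= /l /=.
    by case: (digit _) => [b|] /=.
  apply: (polyb_le (b' := fun qi => nelt c qi.1.1)) => [[q i]|]; last by pb.
  case=> /= Dq; rewrite size_nseq => lt.
  have lti := ltn_trans lt (sizeE q Dq).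
  have := mem_nth 0 lti; rewrite /l /= (perm_mem (elements_perm _)).
  have [sub _ _] := Dq => /(fsubsetP sub)/in_ground[j ltj ->].
  by rewrite blen_exp2 ltnW.
have Py : polyb dom (fun q => size q.1) (fun q => size (y q (cert_bound c q.1))).
  by apply: polyb_le => [q _|]; [apply: size_decode | pb].
apply: pt_seq.
  apply: pt_clr => //=; apply: polyb_le Pu => q _.
  by rewrite -{2}(cat_take_drop (cert_bound c q.1) (enc_set q.2)) enc_words_cat size_cat leq_addl.
rewrite /=; apply: pt_seq; first by apply: pt_push.
rewrite /=; apply: pt_seq; first by apply: pt_mv => //=; pb.
rewrite /=; apply: (pt_eqr (pt_mv _ _ _ _)) => //=; first by pb.
move=> q _; rewrite subnn rev_cons revK map_rev revK cat_rcons !enc_words_cons.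
by lits.
Qed.

Lemma member_poly_time V pV d : (forall xy, exists2 t,
    runs pV (enc_words [:: xy.1; xy.2]) t [:: Some (V xy.1 xy.2)] &
    t <= pbound (size xy.1 + size xy.2) d) ->
  poly_time (fun q => (q.2 `<=` (NPmatroid c V q.1).1)%fset) (fun q => size q.1)
    (fun q => enc_words (q.1 :: enc_set q.2))
    (fun q => [:: Some (q.2 \in (NPmatroid c V q.1).2)]).
Proof.
move=> HV; apply: (rt_poly_time (p := member_prog c pV)).
apply: (@pt_read_params X _ fst (fun q => enc_words (enc_set q.2))); last first.
  by move=> q _; rewrite enc_words_cons.
apply: rt_seq.
  apply: pt_count_words; apply: polyb_le => [q sub|]; first exact: size_enc_subset sub.
  by pb.
have out b q : (q.2 `<=` ground c q.1)%fset -> ((#|` q.2|%fset < rank c q.1) ||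
   (#|` q.2|%fset == rank c q.1) && ((\sum_(e <- q.2) blen e != target c q.1) ||
     V q.1 (decode c q.1 q.2))) = b -> [:: Some b] = [:: Some (q.2 \in (NPmatroid c V q.1).2)].
  by rewrite mem_NPmatroid => -> ->.
apply: rt_case => // o.
case: o => [[b|]|] /=.
- apply: (rt_of_pt (pt_push _ _ _ _ _)) => //= q [sub].
  rewrite ohead_residue count_None_enc size_enc_set => e.
  by apply: out => //; move: e; case: ltngtP.
- apply: (rt_of_pt (pt_push _ _ _ _ _)) => //= q [sub].
  rewrite ohead_residue count_None_enc size_enc_set => e.
  by apply: out => //; move: e; case: ltngtP.
apply: rt_case => // -[a|] /=.
  apply: (rt_of_pt (pt_push _ _ _ _ _)) => //= q [[sub]].
  rewrite !ohead_residue count_None_enc size_enc_set count_bits_enc sum_enc_set.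
  case: eqP => [ek _|]; last by case: ifP.
  case: eqP => [//|/eqP et _]; apply: out => //.
  by rewrite ek eqxx et orbT.
apply: (@rt_sub _ _ dom) => [q [[sub]]|].
  rewrite /= !ohead_residue count_None_enc size_enc_set count_bits_enc sum_enc_set => e1 e2.
  by split=> //; [move: e1|move: e2]; case: ltngtP.
apply: rt_seq.
  apply: pt_eq pt_decode => // q [_ ek et]; last first.
  rewrite count_None_enc count_bits_enc size_enc_set sum_enc_set ek et /residue !leqnn !subnn.
  by lits.
(* A decoded certificate is at most [cert_bound] long, so the verifier's time is polynomial in x
   alone. *)
pose b q := pbound (size q.1 + cert_bound c q.1) d.
apply: (rt_call (b := b)) => /=.
  apply: polyb_mul; first by pb.
  by apply: polyb_exp; pb.
move=> q [sub ek et]; have [t R le] := HV (q.1, decode c q.1 q.2).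
exists t; last by apply: leq_trans le (pbound_monol _ _); rewrite leq_add2l size_decode.
suff -> : (q.2 \in (NPmatroid c V q.1).2) = V q.1 (decode c q.1 q.2) by [].
by rewrite mem_NPmatroid sub ek et ltnn !eqxx.
Qed.

Lemma NPmatroid_decoder V pV d : (forall xy, exists2 t,
    runs pV (enc_words [:: xy.1; xy.2]) t [:: Some (V xy.1 xy.2)] &
    t <= pbound (size xy.1 + size xy.2) d) ->
  matroid_decoder (NPmatroid c V).
Proof.
move=> HV; split; first exact: NPmatroidP.
  exact: ground_poly_time.
exact: member_poly_time HV.
Qed.

End Decode.

(** * The reduction *)

Lemma pt_emit_eq X (D : X -> Prop) sz (n : X -> nat)
    (r0 r1 r2 r3 r4 r5 r6 r7 r8 r9 r10 r11 u : X -> seq symbol) :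
  (forall x, D x -> u x = nseq (n x) None) -> polyb D sz n ->
  pt D sz emit (fun x => [:: r0 x; r1 x; r2 x; r3 x; r4 x; r5 x; r6 x; r7 x; r8 x; r9 x; r10 x; r11 x;
      u x; [::]; [::]])
    (fun x => [:: map some (enc_nat (n x)) ++ None :: r0 x; r1 x; r2 x; r3 x; r4 x; r5 x; r6 x;
      r7 x; r8 x; r9 x; r10 x; r11 x; [::]; [::]; [::]]).
Proof.
move=> eu Pn; apply: pt_eq (pt_emit r0 r1 r2 r3 r4 r5 r6 r7 r8 r9 r10 r11 Pn) => // x Dx.
by rewrite eu.
Qed.

(** * Writing the instance *)

Section Instance.
Variables (c : nat) (plus : bool).
Implicit Types x : word.

(* As bias > (rank - 1) * nelt, a set of fewer than rank elements has weight below the limit. *)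
Definition bias x := nelt c x * nelt c x.
Definition wval x e := bias x + blen e.
(** The subtraction does not truncate on the ground set, where bit lengths are at most [nelt x]. *)
Definition vval x e := bias x + (if plus then blen e else nelt c x - blen e).
Definition limit x := rank c x * bias x + target c x.
(** One more than [rank x] times the bound [bias x + nelt x] on the value of an element, hence above
    the value of a code. *)
Definition precision x := (rank c x * bias x + rank c x * nelt c x).+1.

(** The words [enc_nat 1] are denominators of integers; the one opening [fptas_input] is the
    numerator of eps. *)
Definition record x i : seq word :=
  [:: enc_nat (2 ^ i); enc_nat (vval x (2 ^ i)); enc_nat 1; enc_nat (wval x (2 ^ i)); enc_nat 1].

Definition fptas_input x : seq word :=
  [:: enc_nat 1; enc_nat (precision x); x; enc_nat (limit x); enc_nat 1] ++
  flatten [seq record x i | i <- iota 0 (nelt c x)].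

Definition one := Push 0 None ;; Push 0 (Some true).

(** After the pop, stack 9 is the exponent of the current element and stack 11 the number of records
    written: the former plus one is the bit length, the latter [nelt] minus the bit length. Words
    are written last to first. *)
Definition record_prog :=
  Pop 9 ;;
  one ;; addu None 10 12 7 ;; addu None 9 12 7 ;; Push 12 None ;; emit ;;
  one ;; addu None 10 12 7 ;; (if plus then addu None 9 12 7 ;; Push 12 None else addu None 11 12 7) ;;
  emit ;;
  Push 0 None ;; Push 0 (Some true) ;; addu (Some false) 9 0 7 ;; Push 11 None.

(** The parameters stay on stacks 2 to 6, where the check of the scheme's answer finds them. *)
Definition instance_prog :=
  readx ;; params c ;;
  addu None 5 9 7 ;; mulu None 5 9 10 7 8 ;;
  While 9 nonempty record_prog ;;
  one ;; mulu None 4 10 12 7 8 ;; addu None 6 12 7 ;; emit ;;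
  mv 1 0 ;;
  mulu None 4 10 12 7 8 ;; mulu None 4 5 12 7 8 ;; Push 12 None ;; emit ;;
  one ;; clr 10 ;; clr 11.

Lemma pt_record (acc : word * nat -> seq word) :
  pt (fun xi : word * nat => xi.2 < nelt c xi.1) (fun xi => size xi.1) record_prog
  (fun xi => let: (x, i) := xi in [:: enc_words (acc xi); None :: rev (map some x);
    nseq (cert_bound c x) None; nseq (npos c x) None; nseq (rank c x) None; nseq (nelt c x) None;
    nseq (target c x) None; [::]; [::]; nseq (nelt c x - i) None; nseq (bias x) None;
    nseq i None; [::]; [::]; [::]])
  (fun xi => let: (x, i) := xi in [:: enc_words (record x (nelt c x - i.+1) ++ acc xi);
    None :: rev (map some x);
    nseq (cert_bound c x) None; nseq (npos c x) None; nseq (rank c x) None; nseq (nelt c x) None;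
    nseq (target c x) None; [::]; [::]; nseq (nelt c x - i.+1) None; nseq (bias x) None;
    nseq i.+1 None; [::]; [::]; [::]]).
Proof.
pose D (xi : word * nat) := xi.2 < nelt c xi.1.
have Pn : polyb D (fun xi => size xi.1) (fun xi => nelt c xi.1) by pb.
have Pb : polyb D (fun xi => size xi.1) (fun xi => bias xi.1) by apply: polyb_mul.
have Pi : polyb D (fun xi => size xi.1) (fun xi => xi.2).
  by apply: polyb_le Pn => xi; apply: ltnW.
have Pni : polyb D (fun xi => size xi.1) (fun xi => nelt c xi.1 - xi.2.+1).
  by apply: polyb_le Pn => xi _; apply: leq_subr.
have Pw : polyb D (fun xi => size xi.1) (fun xi => bias xi.1 + (nelt c xi.1 - xi.2.+1).+1) by pb.
have Pv : polyb D (fun xi => size xi.1) (fun xi => bias xi.1 + xi.2) by pb.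
pose r0 xi := enc_words (acc xi).
apply: (pt_eq (s1' := fun xi => [:: r0 xi; None :: rev (map some xi.1);
    nseq (cert_bound c xi.1) None; nseq (npos c xi.1) None; nseq (rank c xi.1) None; nseq (nelt c xi.1) None;
    nseq (target c xi.1) None; [::]; [::]; nseq (nelt c xi.1 - xi.2) None; nseq (bias xi.1) None;
    nseq xi.2 None; [::]; [::]; [::]])) => [[x i] _ j|xi Dxi j|]; first by []; first exact: erefl.
apply: (pt_seq (s2 := fun xi => [:: r0 xi; None :: rev (map some xi.1);
    nseq (cert_bound c xi.1) None; nseq (npos c xi.1) None; nseq (rank c xi.1) None; nseq (nelt c xi.1) None;
    nseq (target c xi.1) None; [::]; [::]; nseq (nelt c xi.1 - xi.2.+1) None; nseq (bias xi.1) None;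
    nseq xi.2 None; [::]; [::]; [::]])).
  by apply: (pt_eqr (pt_pop _ _ _ _)) => // xi _; rewrite /= behead_nseq subnS.
apply: pt_seq; first by apply: pt_seq; [apply: pt_push | apply: pt_push].
rewrite /=; apply: pt_seq; first by apply: pt_addu => //=; pb.
rewrite /=; apply: pt_seq; first by apply: pt_addu => //=; pb.
rewrite /=; apply: pt_seq; first by apply: pt_push.
rewrite /=; apply: pt_seq.
  apply: (@pt_emit_eq _ _ _ (fun xi => bias xi.1 + (nelt c xi.1 - xi.2.+1).+1)) => // xi _.
  by rewrite /= !unaryE; congr nseq; lia.
apply: pt_seq; first by apply: pt_seq; [apply: pt_push | apply: pt_push].
rewrite /=; apply: pt_seq; first by apply: pt_addu => //=; pb.
rewrite /=; apply: (pt_seq (s2 := fun xi => 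
    [:: Some true :: None :: map some (enc_nat (bias xi.1 + (nelt c xi.1 - xi.2.+1).+1)) ++
      None :: Some true :: None :: r0 xi; None :: rev (map some xi.1);
    nseq (cert_bound c xi.1) None; nseq (npos c xi.1) None; nseq (rank c xi.1) None; nseq (nelt c xi.1) None;
    nseq (target c xi.1) None; [::]; [::]; nseq (nelt c xi.1 - xi.2.+1) None; nseq (bias xi.1) None;
    nseq xi.2 None; nseq (bias xi.1 + if plus then (nelt c xi.1 - xi.2.+1).+1 else xi.2) None; [::]; [::]])).
  case: plus.
    apply: pt_seq; first by apply: pt_addu => //=; pb.
    apply: (pt_eqr (pt_push _ _ _ _ _)) => // xi _.
    by rewrite /= !unaryE (addnC _ (bias _)) addnS.
  apply: (pt_eqr (pt_addu _ _ _ _ _ _ _)) => //=; first by pb.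
  by move=> xi _; rewrite !unaryE (addnC _ (bias _)).
apply: pt_seq.
  apply: (@pt_emit_eq _ _ _ (fun xi => bias xi.1 + if plus then (nelt c xi.1 - xi.2.+1).+1 else xi.2)) => //.
  by case: plus; pb.
apply: pt_seq; first by apply: pt_push.
rewrite /=; apply: pt_seq; first by apply: pt_push.
rewrite /=; apply: pt_seq; first by apply: pt_addu => //=; pb.
rewrite /=; apply: (pt_eqr (pt_push _ _ _ _ _)) => // -[x i] lt.
rewrite /= !enc_words_cons /wval /vval !blen_exp2 /= size_nseq.
have -> : nelt c x - (nelt c x - i.+1).+1 = i by move: lt; rewrite /=; lia.
rewrite [enc_nat (2 ^ _)]enc_nat_exp2 map_rcons map_nseq cat_rcons.
by lits.
Qed.

Lemma pt_instance : pt (fun=> True) size instance_prog (fun x => [:: enc_words [:: x]])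
  (fun x => [:: enc_words (fptas_input x); [::]; nseq (cert_bound c x) None; nseq (npos c x) None;
    nseq (rank c x) None; nseq (nelt c x) None; nseq (target c x) None]).
Proof.
pose D (x : word) := True.
have Pn : polyb D size (nelt c) by apply: (@polyb_nelt word D id).
have Pt : polyb D size (target c) by apply: (@polyb_target word D id).
have Pk : polyb D size (rank c) by apply: (@polyb_rank word D id).
have Pb : polyb D size bias by apply: polyb_mul.
apply: pt_seq.
  apply: pt_eq (pt_readx (fun=> [::]) (polyb_size _ _)) => // x _.
  by rewrite enc_words_cons; lits.
apply: pt_seq; first by apply: (@pt_params word _ id) => x _; rewrite /= size_rev size_map.
rewrite /=; apply: pt_seq; first by apply: pt_addu => //=; pb.
rewrite /=; apply: pt_seq; first by apply: pt_mulu => //=; pb.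
rewrite /=; pose inv x i := [:: enc_words (flatten [seq record x j | j <- iota (nelt c x - i) i]);
    None :: rev (map some x);
    nseq (cert_bound c x) None; nseq (npos c x) None; nseq (rank c x) None; nseq (nelt c x) None;
    nseq (target c x) None; [::]; [::]; nseq (nelt c x - i) None; nseq (bias x) None;
    nseq i None; [::]; [::]; [::]].
apply: (pt_seq (s2 := fun x => inv x (nelt c x))).
  apply: (pt_while_list (inv := inv)) => //=.
  - by pb.
  - by move=> x _; rewrite /inv subn0 !unaryE; lits.
  - by move=> x _; rewrite !unaryE.
  - by move=> x i _; rewrite !unaryE.
  apply: (@pt_sub _ _ _ (fun xi => xi.2 < nelt c xi.1)) => [[x i] [_ /=]|].
    by rewrite !unaryE.
  apply: pt_eq (pt_record (fun xi => flatten [seq record xi.1 j | j <- iota (nelt c xi.1 - xi.2) xi.2])).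
    by case.
  move=> [x i] /= lt j; rewrite /inv.
  by have -> : nelt c x - i = (nelt c x - i.+1).+1 by lia.
rewrite /inv; apply: pt_seq; first by apply: pt_seq; [apply: pt_push | apply: pt_push].
rewrite /=; apply: pt_seq; first by apply: pt_mulu => //=; pb.
rewrite /=; apply: pt_seq; first by apply: pt_addu => //=; pb.
rewrite /=; apply: pt_seq.
  apply: (@pt_emit_eq _ _ _ limit) => [x _|]; last by apply: polyb_add => //; apply: polyb_mul.
  by rewrite /= !unaryE addnC.
apply: pt_seq; first by apply: pt_mv => //=; pb.
rewrite /=; apply: pt_seq; first by apply: pt_mulu => //=; pb.
rewrite /=; apply: pt_seq; first by apply: pt_mulu => //=; pb.
rewrite /=; apply: pt_seq; first by apply: pt_push.
rewrite /=; apply: pt_seq.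
  apply: (@pt_emit_eq _ _ _ precision) => [x _|]; last by pb.
  by rewrite /= !unaryE addnC.
apply: pt_seq; first by apply: pt_seq; [apply: pt_push | apply: pt_push].
rewrite /=; apply: pt_seq; first by apply: pt_clr => //=; pb.
rewrite /=; apply: (pt_eqr (pt_clr _ _)) => //=; first by pb.
move=> x _; rewrite subnn /fptas_input /= !enc_words_cons rev_cons revK cat_rcons.
by lits.
Qed.

End Instance.

(** * Near-optimal solutions of the instance *)

Lemma enc_rat_nat n : enc_rat (n%:R)%R = [:: enc_nat n; enc_nat 1].
Proof. by rewrite /enc_rat -[(n%:R)%R]/(n%:~R)%R numq_int denq_int. Qed.

Lemma enc_rat_inv n : 0 < n -> enc_rat (n%:R^-1)%R = [:: enc_nat 1; enc_nat n].
Proof.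
move=> n0; have -> : (n%:R^-1 = 1%:~R / n%:~R :> rat)%R by rewrite mul1r.
rewrite /enc_rat coprimeq_num ?coprimeq_den ?coprime1n //.
by case: n n0 => // n _; rewrite gtr0_sg // mul1r.
Qed.

Lemma basesP (N : set_system) S :
  reflect (S \in N.2 /\ forall A, A \in N.2 -> #|` A|%fset <= #|` S|%fset) (S \in bases N).
Proof.
rewrite !inE; have P := @allP _ (fun A : {fset nat} => #|` A|%fset <= #|` S|%fset) (enum_fset N.2).
apply: (iffP andP) => -[SN max]; split=> //; first by move=> A AN; apply: (elimT P max).
by apply: (introT P) => A AN; apply: max.
Qed.

Section Reduction.
Variables (c : nat) (V : word -> word -> bool) (P : problem).
Implicit Types (x y : word) (S : {fset nat}).
Notation M := (NPmatroid c V).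

(** For [Max] with [Le] and [Min] with [Ge], taking v = w already bounds the weight from both sides;
    in the other cases v must fall as the bit length grows. *)
Definition plus_of (P : problem) : bool :=
  match P with (Max, _, Le) | (Min, _, Ge) => true | _ => false end.
Notation plus := (plus_of P).

Definition eps_of x : rat := ((precision c x)%:R^-1)%R.
Definition inst x : instance :=
  Instance x (fun e => (vval c plus x e)%:R%R) (fun e => (wval c x e)%:R%R) (limit c x)%:R%R.

Lemma eps_gt0 x : (0 < eps_of x)%R.
Proof. by rewrite invr_gt0 ltr0n. Qed.

Lemma valid_inst x : valid_instance M (inst x).
Proof. by split=> [e _|] /=; rewrite ?ler0n. Qed.

Lemma fptas_inputE x : fptas_input c plus x = enc_rat (eps_of x) ++ enc_instance M (inst x).
Proof.
rewrite enc_rat_inv // /enc_instance [iL _]/= enc_rat_nat [iI _]/= elements_ground -map_comp.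
rewrite /fptas_input; do 5!congr (_ :: _); congr flatten; apply: eq_map => i.
by rewrite /comp [iv _ _]/= [iw _ _]/= !enc_rat_nat.
Qed.

Lemma weight_nat (g : nat -> nat) S : weight (fun e => (g e)%:R)%R S = ((\sum_(e <- S) g e)%N%:R)%R.
Proof. by rewrite /weight natr_sum. Qed.

Lemma sum_wval x S : \sum_(e <- S) wval c x e = #|` S|%fset * bias c x + \sum_(e <- S) blen e.
Proof. by rewrite big_split /= big_const_seq count_predT iter_addn_0 mulnC. Qed.

Lemma sum_vval x S : (S `<=` ground c x)%fset -> \sum_(e <- S) vval c plus x e =
  #|` S|%fset * bias c x + if plus then \sum_(e <- S) blen e
    else #|` S|%fset * nelt c x - \sum_(e <- S) blen e.
Proof.
move=> sub; rewrite big_split /= big_const_seq count_predT iter_addn_0 mulnC; congr addn.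
case: plus => //; apply/eqP; rewrite -(eqn_add2r (\sum_(e <- S) blen e)) subnK ?sum_blen_le //.
rewrite -big_split /= big_seq (eq_bigr (fun=> nelt c x)) => [|e /(fsubsetP sub)/in_ground[i lt ->]].
  by rewrite -big_seq big_const_seq count_predT iter_addn_0 mulnC.
by rewrite blen_exp2 subnK.
Qed.

(** The value of any set of [rank x] elements and weight [target x]. *)
Definition best x := rank c x * bias c x + if plus then target c x else rank c x * nelt c x - target c x.

Lemma target_le x : target c x <= rank c x * nelt c x.
Proof. by rewrite targetE rankE neltE nposE; nia. Qed.

Lemma best_lt x : best x < precision c x.
Proof. by have := target_le x; rewrite /best /precision; case: plus; lia. Qed.

Lemma code_indep x y : size y <= cert_bound c x -> V x y -> code c x y \in (M x).2.
Proof. by move=> le Vy; rewrite mem_NPmatroid code_sub card_code eqxx decode_code // Vy !orbT. Qed.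

Lemma indep_card x S : S \in (M x).2 -> #|` S|%fset <= rank c x.
Proof. by rewrite in_paving => /andP[_ /paving_indep_card]. Qed.

(** A code meets the constraint with equality, hence for either relation, and its cardinality makes
    it a base. *)
Lemma code_solution x y : size y <= cert_bound c x -> V x y ->
  solution M P (inst x) (code c x y).
Proof.
move=> le Vy; have iC := code_indep le Vy.
rewrite /solution; case: P => [[o F] rel]; split.
  by case: F => //; apply/basesP; split=> // A; rewrite card_code; apply: indep_card.
by case: rel => /=; rewrite weight_nat sum_wval card_code sum_code.
Qed.

Lemma solution_indep x S : solution M P (inst x) S -> S \in (M x).2.
Proof.
by rewrite /solution; case: P => [[o []] rel] [] // /basesP[].
Qed.

Lemma sum_code_vval x y : \sum_(e <- code c x y) vval c plus x e = best x.
Proof. by rewrite sum_vval ?code_sub // card_code sum_code. Qed.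

(* With precision > best, a relative error of 1/precision cannot reach the next integer. *)
Lemma approx_value x y S : size y <= cert_bound c x -> V x y ->
  approx_solution M P (1 + eps_of x)%R (inst x) S ->
  match P.1.1 with
  | Max => best x <= \sum_(e <- S) vval c plus x e
  | Min => \sum_(e <- S) vval c plus x e <= best x
  end.
Proof.
move=> le Vy [_ [z [_ opt]]]; have := opt _ (code_solution le Vy).
have lt := best_lt x; set s := \sum_(e <- S) _.
have Q0 : (0 < (precision c x)%:R :> rat)%R by rewrite ltr0n.
have eE : (1 + eps_of x = ((precision c x).+1)%:R / (precision c x)%:R :> rat)%R.
  by rewrite /eps_of -addn1 natrD mulrDl divff ?gt_eqF // addrC mul1r addrC.
case: P.1.1 => /=; rewrite !weight_nat sum_code_vval -/s eE => h1 h2.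
  have : ((best x * precision c x)%:R <= (s * (precision c x).+1)%:R :> rat)%R.
    rewrite !natrM -ler_pdivrMr ?ltr0n // -mulrA -invf_div; apply: le_trans h2.
    by rewrite invf_div ler_wpM2r // divr_ge0 ?ler0n.
  (* With Q the precision, s < best would give s (Q + 1) <= best Q + best - Q - 1 < best Q. *)
  rewrite ler_nat; nia.
have : ((s * precision c x)%:R <= ((precision c x).+1 * best x)%:R :> rat)%R.
  rewrite !natrM -ler_pdivlMr // mulrAC; apply: le_trans h2 _.
  by rewrite ler_wpM2l // divr_ge0 ?ler0n.
(* Here s > best would give s Q >= best Q + Q > best Q + best. *)
rewrite ler_nat; nia.
Qed.

(** The cardinality comes first: for bases by comparison with a code, otherwise from a lower bound
    supplied by the constraint for [Ge] and by the value for [Max] with [Le]; the excluded problem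
    has neither. Then constraint and value bound the weight from opposite sides. *)
Lemma approx_target x y S : in_Q P -> size y <= cert_bound c x -> V x y ->
  approx_solution M P (1 + eps_of x)%R (inst x) S ->
  #|` S|%fset = rank c x /\ \sum_(e <- S) blen e = target c x.
Proof.
move=> inQ le Vy apx; have val := approx_value le Vy apx.
have [sol _] := apx; have iS := solution_indep sol.
have nk := indep_card iS; have sub : (S `<=` ground c x)%fset by move: iS; rewrite in_paving => /andP[].
have sn := sum_blen_le sub; have tl := target_le x.
move: val sol; rewrite sum_vval // /best.
set n := #|` S|%fset in nk sn *; set s := \sum_(e <- S) _ in sn *.
have kN : rank c x < nelt c x by rewrite rankE neltE nposE; lia.
(* If n < rank, then s <= n * nelt < nelt * nelt = bias: bit lengths cannot make up for a missing
   element. *)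
have big : rank c x * bias c x + target c x <= n * bias c x + s -> n = rank c x.
  by rewrite /bias; nia.
rewrite /solution; case: P inQ => [[o F] rel] inQ /= val [SF].
have nE : F = Bases -> n = rank c x.
  move=> eF; move: SF; rewrite eF => /basesP[_ /(_ _ (code_indep le Vy))].
  by rewrite card_code /n; move: nk; lia.
move=> rw.
have nk' : n = rank c x.
  case: F {SF} nE inQ => [->//|_ inQ]; apply: big.
  by case: o rel inQ val rw => -[] inQ //=; rewrite weight_nat sum_wval ler_nat.
move: sn rw val; rewrite nk'.
by case: o {inQ}; case: rel; rewrite /= ?weight_nat ?sum_wval ?ler_nat /limit -/n -/s ?nk'; lia.
Qed.

End Reduction.

(** * Checking the answer of the scheme *)

(** The report that no solution exists is already the rejecting output, hence [Skip]. A returned set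
    is known to be independent, so that only its cardinality and weight are tested. *)
Definition verify_prog := Case 0 (fun o => if o is Some (Some true) then
    Pop 0 ;; count_words ;; Case 4 (fun o => if o is Some _ then answer false else
      Case 6 (fun o => answer (o == None)))
  else Skip).

Section Verify.
Variable c : nat.
Notation Y := (option {fset nat}).

Definition check x (r : Y) :=
  if r is Some B then (#|` B|%fset == rank c x) && (\sum_(e <- B) blen e == target c x) else false.

Definition answer_words (r : Y) := if r is Some B then enc_set B else [::].

Lemma pt_verify (D : word * Y -> Prop) :
  polyb D (fun xr => size xr.1) (fun xr => size (enc_answer xr.2)) ->
  pt D (fun xr => size xr.1) verify_prog
  (fun xr => [:: enc_answer xr.2; [::]; nseq (cert_bound c xr.1) None; nseq (npos c xr.1) None;
    nseq (rank c xr.1) None; nseq (nelt c xr.1) None; nseq (target c xr.1) None])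
  (fun xr => let u := enc_words (answer_words xr.2) in
    [:: [:: Some (check xr.1 xr.2)]; [::]; nseq (cert_bound c xr.1) None; nseq (npos c xr.1) None;
    residue (rank c xr.1) (count_mem None u); nseq (nelt c xr.1) None;
    residue (target c xr.1) (count (predC1 None) u); [::]; rev u]).
Proof.
move=> Pa; apply: pt_case => // o.
have skip : o <> Some (Some true) -> pt (fun xr => D xr /\ ohead (enc_answer xr.2) = o)
    (fun xr => size xr.1) Skip
  (fun xr => [:: enc_answer xr.2; [::]; nseq (cert_bound c xr.1) None; nseq (npos c xr.1) None;
    nseq (rank c xr.1) None; nseq (nelt c xr.1) None; nseq (target c xr.1) None])
  (fun xr => let u := enc_words (answer_words xr.2) in
    [:: [:: Some (check xr.1 xr.2)]; [::]; nseq (cert_bound c xr.1) None; nseq (npos c xr.1) None;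
    residue (rank c xr.1) (count_mem None u); nseq (nelt c xr.1) None;
    residue (target c xr.1) (count (predC1 None) u); [::]; rev u]).
  move=> no; apply: (pt_eqr (pt_skip _ _ _)) => -[x [B|]] [_ /= e]; first by case: no.
  by rewrite !residue0; lits.
case: o skip => [[[|]|]|] skip; try exact: skip.
apply: pt_seq; first by apply: pt_pop.
have sub (xr : word * Y) : D xr /\ ohead (enc_answer xr.2) = Some (Some true) ->
    behead (enc_answer xr.2) = enc_words (answer_words xr.2).
  by case: xr => x [B|] [].
apply: pt_seq.
  apply: pt_count_words; apply: (@polyb_sub _ _ D) => [xr []//|].
  by apply: polyb_le Pa => xr _; rewrite size_behead leq_pred.
have fin b (D' : word * Y -> Prop) :
    (forall xr, D' xr -> D xr /\ ohead (enc_answer xr.2) = Some (Some true)) ->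
    (forall xr, D' xr -> check xr.1 xr.2 = b) ->
    pt D' (fun xr => size xr.1) (answer b) (fun xr => let u := behead (enc_answer xr.2) in
    [:: [::]; [::]; nseq (cert_bound c xr.1) None; nseq (npos c xr.1) None;
    residue (rank c xr.1) (count_mem None u); nseq (nelt c xr.1) None;
    residue (target c xr.1) (count (predC1 None) u); [::]; rev u])
  (fun xr => let u := enc_words (answer_words xr.2) in
    [:: [:: Some (check xr.1 xr.2)]; [::]; nseq (cert_bound c xr.1) None; nseq (npos c xr.1) None;
    residue (rank c xr.1) (count_mem None u); nseq (nelt c xr.1) None;
    residue (target c xr.1) (count (predC1 None) u); [::]; rev u]).
  move=> DD e; apply: (pt_eqr (pt_push _ _ _ _ _)) => // xr Dxr.
  by rewrite /= e // sub //; apply: DD.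
have checkE (xr : word * Y) : D xr /\ ohead (enc_answer xr.2) = Some (Some true) ->
    check xr.1 xr.2 =
    (ohead (residue (rank c xr.1) (count_mem None (behead (enc_answer xr.2)))) == None) &&
    (ohead (residue (target c xr.1) (count (predC1 None) (behead (enc_answer xr.2)))) == None).
  case: xr => x [B|] [_] //= _; rewrite !ohead_residue count_None_enc count_bits_enc.
  by rewrite size_enc_set sum_enc_set; do 2!case: ltngtP.
apply: pt_case => // -[a|].
  apply: fin => [xr []//|xr [Dxr /= e]].
  by rewrite checkE // e.
apply: pt_case => // o; apply: fin => [xr [[]]//|xr [[Dxr /= e] e']].
by rewrite checkE // e e'.
Qed.

End Verify.

(** * An FPTAS decides the language *)

Section Decide.
Variables (c : nat) (V : word -> word -> bool) (P : problem) (L : language).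
Hypothesis LV : forall x, L x <-> exists2 y : word, size y <= cert_bound c x & V x y.
Hypothesis inQ : in_Q P.
Notation M := (NPmatroid c V).

(** A set that passes is independent despite having weight [target], so it decodes to a certificate.
    Conversely a certificate gives a solution, so the scheme must return a set, and a near-optimal
    one passes. *)
Lemma check_correct x (r : option {fset nat}) :
  match r with
  | Some B => approx_solution M P (1 + eps_of c x)%R (inst c P x) B
  | None => forall S, ~ solution M P (inst c P x) S
  end -> check c x r = L x.
Proof.
move=> good; apply/idP/idP => [|/LV[y le Vy]].
  case: r good => //= B [sol _] /andP[/eqP nk st].
  have := solution_indep sol; rewrite mem_NPmatroid nk ltnn st eqxx /= => /andP[_ Vd].
  by apply/LV; exists (decode c x B) => //; apply: size_decode.
case: r good => [B apx|none]; last by case: (none _ (code_solution P le Vy)).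
by rewrite /check; have [-> ->] := approx_target inQ le Vy apx; rewrite !eqxx.
Qed.

Lemma FPTAS_class_P : has_FPTAS M P -> class_P L.
Proof.
move=> [A [cA HA]].
apply: (rt_poly_time (p := instance_prog c (plus_of P) ;; call A ;; verify_prog)).
have ptI := pt_instance c (plus_of P).
have Pin : polyb (fun=> True) size (fun x => size (enc_words (fptas_input c (plus_of P) x))).
  apply: (pt_size (r := 0) _ ptI) => //=.
  apply: (polyb_le (b' := fun x => (size x).+1)); last by pb.
  by move=> x _; rewrite enc_words_cons size_cat size_map /= addn1.
pose D (x : word) := True.
have Pn : polyb D size (nelt c) by apply: (@polyb_nelt word D id).
have Pk : polyb D size (rank c) by apply: (@polyb_rank word D id).
have Pq : polyb D size (precision c) by rewrite /precision /bias; pb.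
apply: (rt_seq ptI).
(* The time bound of the scheme for [eps_of x], whose inverse is [precision c x]. *)
pose b x := cA * (size (enc_words (fptas_input c (plus_of P) x)) + precision c x) ^ cA.
apply: (rt_call_pt (b := b) (ans := enc_answer) (good := fun x r => match r with
  | Some B => approx_solution M P (1 + eps_of c x)%R (inst c P x) B
  | None => forall S, ~ solution M P (inst c P x) S end)
  (s' := fun xr => let u := enc_words (answer_words xr.2) in
    [:: [:: Some (check c xr.1 xr.2)]; [::]; nseq (cert_bound c xr.1) None; nseq (npos c xr.1) None;
    residue (rank c xr.1) (count_mem None u); nseq (nelt c xr.1) None;
    residue (target c xr.1) (count (predC1 None) u); [::]; rev u])) => //=.
- apply: polyb_mul; first by pb.
  by apply: polyb_exp; apply: polyb_add.
- move=> x _; have [t [r [R le good]]] := HA _ _ (eps_gt0 c x) (valid_inst c V P x).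
  rewrite -fptas_inputE in R le; exists t, r; split=> //.
  by move: le; rewrite /eps_of invrK -natrD -natrX -natrM ler_nat.
- move=> d Pd; apply: pt_verify.
  apply: (polyb_le (b' := fun xr => d xr.1)); first by case=> x r [].
  by apply: (polyb_comp (f := fst)) Pd.
by move=> x r _ good; rewrite (check_correct good).
Qed.

End Decide.

Theorem theorem4p3 :
  P_neq_NP ->
  forall P : problem, in_Q P ->
  exists f : word -> set_system, matroid_decoder f /\ ~ has_FPTAS f P.
Proof.
(* If no such decoder existed, the schemes for the decoders [NPmatroid c V] would put every language
   of NP into P. *)
move=> PNP P inQ; apply: NNPP => no; apply: PNP => L; split; first exact: class_P_NP.
case=> V [pV [d HV]] [c LV].
apply: (FPTAS_class_P LV inQ); apply: NNPP => noF; apply: no.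
exists (NPmatroid c V); split=> //.
by apply: (@NPmatroid_decoder _ _ pV d) => xy; apply: HV.
Qed.
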